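(* Consider an NGNEP (nonlinear generalized Nash equilibrium problem, defined in the context) that is either monotone (the case $\alpha=0$) or $\alpha$-strongly monotone with $\alpha>0$. For a given tolerance $\epsilon>0$, the required number of gradient evaluations for the AMPQP algorithm (defined in the context) to return an $\epsilon$-solution is upper bounded by $$N_{\mathrm{grad}}=\begin{cases} O(\epsilon^{-1}), & \text{if } \alpha=0,\\ O(\epsilon^{-1/2}\log(1/\epsilon)), & \text{if } \alpha>0,\end{cases}$$ where the two lines refer to the case of monotone and strongly monotone NGNEPs.
   Context: **Notation.** All norms are Euclidean (spectral for matrices); $\max$ of vectors is componentwise. For a tolerance $\epsilon\in(0,1)$, $a=O(b)$ means $a\le C\,b$ with $C$ independent of the dimension $n$ and of $1/\epsilon$ ($C$ may depend on the other problem data and on the algorithm inputs); $a=\tilde O(b)$ means the same inequality where $C$ may depend on log factors of $n$ and $1/\epsilon$. **NGNEP.** Players $\nu\in\mathcal N=\{1,\dots,N\}$; player $\nu$ chooses $x^\nu\in\mathbb R^{n_\nu}$, $n=n_1+\dots+n_N$, $x=(x^1,\dots,x^N)=(x^\nu;x^{-\nu})\in\mathbb R^n$. There are (not necessarily disjoint) subsets $\mathcal N_1,\dots,\mathcal N_S$ with $\mathcal N=\bigcup_{s=1}^S\mathcal N_s$; each $\mathcal N_s$ comes with $A_s\in\mathbb R^{m_s\times\sum_{i\in\mathcal N_s}n_i}$, $b_s\in\mathbb R^{m_s}$, $E_s\in\mathbb R^{e_s\times\sum_{i\in\mathcal N_s}n_i}$, $d_s\in\mathbb R^{e_s}$. $x^{\mathcal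 N_s}$ is the concatenation of $x^i$, $i\in\mathcal N_s$; $A_s^i,E_s^i$ are the column blocks of $A_s,E_s$ acting on $x^i$, so $A_sx^{\mathcal N_s}=\sum_{i\in\mathcal N_s}A_s^ix^i$. $\mathcal I_\nu=\{s:\nu\in\mathcal N_s\}$. For each $\nu$, $\hat X_\nu\subset\mathbb R^{n_\nu}$ is convex and compact (and ''simple'': projection onto it has a closed form or can be computed efficiently), $\hat X=\prod_\nu\hat X_\nu$, and the strategy set of player $\nu$ is $X_\nu(x^{-\nu})=\{x^\nu\in\hat X_\nu: A_sx^{\mathcal N_s}\le b_s,\ E_sx^{\mathcal N_s}=d_s\ \forall s\in\mathcal I_\nu\}$. The cost $\theta_\nu:\mathbb R^n\to\mathbb R$ of player $\nu$ is continuously differentiable with $\|\nabla_\nu\theta_\nu(x)-\nabla_\nu\theta_\nu(x')\|\le\ell_\theta\|x-x'\|$ for all $x,x'\in\hat X$ ($\nabla_\nu$ is the partial gradient in $x^\nu$). Put $v_\nu(x)=\nabla_\nu\theta_\nu(x)$, $v=(v_1,\dots,v_N)$. The NGNEP is monotone if $(x-x')^\top(v(x)-v(x'))\ge0$ for all $x,x'\in\hat X$, and $\alpha$-strongly monotone if $(x-x')^\top(v(x)-v(x'))\ge\alpha\|x-x'\|^2$ for all $x,x'\in\hat X$. **$\epsilon$-solution.** $\bar x\in\hat X$ is an $\epsilon$-solution if (i) $\|\max\{0,A_s\bar x^{\mathcal N_s}-b_s\}\|\le\epsilon$ and $\|E_s\bar x^{\mathcal N_s}-d_s\|\le\epsilon$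 for all $s\in\{1,\dots,S\}$; and (ii) for every $\nu\in\mathcal N$, $(\bar x^\nu-x^\nu)^\top v_\nu(x^\nu,\bar x^{-\nu})=\tilde O(\epsilon)$ for all $x^\nu\in\hat X_\nu$ satisfying $\|\max\{0,A_s^\nu x^\nu+\sum_{j\in\mathcal N_s,j\ne\nu}A_s^j\bar x^j-b_s\}\|\le\epsilon$ and $\|E_s^\nu x^\nu+\sum_{j\in\mathcal N_s,j\neq\nu}E_s^j\bar x^j-d_s\|\le\epsilon$ for all $s\in\mathcal I_\nu$. **AMP (accelerated mirror-prox).** For a closed convex set $Z$, an $\ell_F$-Lipschitz (strongly) monotone $F$ and a convex $\ell_G$-smooth $G$ (gradient $\ell_G$-Lipschitz), starting at $z_1=z_1^{\mathrm{ag}}=w_1\in Z$, iterate $z_k^{\mathrm{md}}=(1-\alpha_k)z_k^{\mathrm{ag}}+\alpha_kw_k$; $z_{k+1}=\operatorname{argmin}_{z\in Z}\gamma_k(z-w_k)^\top(F(w_k)+\nabla G(z_k^{\mathrm{md}}))+\frac12\|z-w_k\|^2$; $w_{k+1}=\operatorname{argmin}_{z\in Z}\gamma_k(z-w_k)^\top(F(z_{k+1})+\nabla G(z_k^{\mathrm{md}}))+\frac12\|z-w_k\|^2$; $z_{k+1}^{\mathrm{ag}}=(1-\alpha_k)z_k^{\mathrm{ag}}+\alpha_kz_{k+1}$. Parameters: $\alpha_k=\frac2{k+1}$, $\gamma_k=\frac{k}{4\ell_G+3k\ell_F}$ in the monotone case; $\alpha_k=\frac14\min\{\frac{\alpha}{\ell_F},\sqrt{\frac{\alpha}{\ell_G}}\}$,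 $\gamma_k=\alpha_k/\alpha$ in the $\alpha$-strongly monotone case. Gradient evaluations are evaluations of $F$ and of $\nabla G$. **AMPQP algorithm (accelerated mirror-prox quadratic penalty method).** Inputs: $\gamma>1$, $\delta_0\in(0,1)$, $x_0\in\hat X$, initial penalty parameters $\beta_0^s,\rho_0^s>0$ for $s=1,\dots,S$. For $k=0,\dots,T-1$: set $(\beta_{k+1}^s,\rho_{k+1}^s)=(\gamma\beta_k^s,\gamma\rho_k^s)$ for all $s$ and $\delta_{k+1}=\delta_k/\gamma$; with $g_1(x)=\sum_{s=1}^S\frac{\beta_{k+1}^s}{2}\|\max\{0,A_sx^{\mathcal N_s}-b_s\}\|^2$ and $h_1(x)=\sum_{s=1}^S\frac{\rho_{k+1}^s}{2}\|E_sx^{\mathcal N_s}-d_s\|^2$, run AMP from starting point $x_k$ with $Z=\hat X$, $F=v$, $G=g_1+h_1$, $\ell_F=\sqrt N\ell_\theta$, $\ell_G=\sum_{s=1}^S(\beta_{k+1}^s\|A_s\|^2+\rho_{k+1}^s\|E_s\|^2)$, to obtain a point $x_{k+1}\in\hat X$ with $\max_{x\in\hat X}\{g_1(x_{k+1})+h_1(x_{k+1})-g_1(x)-h_1(x)+(x_{k+1}-x)^\top v(x)\}\le\delta_{k+1}$. Output: $x_T$.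
   Formalization: The NGNEP is assumed to have a feasible KKT point with bounded Lagrange multipliers shared by the players (the claim fails if infeasible or without multipliers); for α>0 the bound is stated for ε at most a fixed cutoff below 1, on which the constant may depend. *)

(* Defs.v *)
From HB Require Import structures.
From mathcomp Require Import all_boot all_order all_algebra.
From mathcomp Require Import all_classical all_reals all_analysis.

Set Implicit Arguments.
Unset Strict Implicit.
Unset Printing Implicit Defensive.

Import Order.TTheory GRing.Theory Num.Theory.
Import numFieldNormedType.Exports.

Local Open Scope classical_set_scope.
Local Open Scope ring_scope.

Section Euclidean.
Variable R : realType.

Definition dot n (u v : 'cV[R]_n) : R := \sum_i u i 0 * v i 0.

(* The library norm `|u| on matrices is the sup norm; it is only used through
   the topology (compactness, derivatives), which is the Euclidean one. *)
Definition enorm n (u : 'cV[R]_n) : R := Num.sqrt (dot u u).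

Definition specnorm m n (A : 'M[R]_(m, n)) : R :=
  sup [set enorm (A *m u) | u in [set u : 'cV[R]_n | enorm u <= 1]].

Definition pospart n (u : 'cV[R]_n) : 'cV[R]_n := map_mx (Num.max 0) u.

Definition grad n (f : 'cV[R]_n -> R) (x : 'cV[R]_n) : 'cV[R]_n :=
  \col_i 'D_(delta_mx i 0) f x.

Definition C1 n (f : 'cV[R]_n -> R) : Prop :=
  (forall x, differentiable f x) /\ continuous (grad f).

(* A minimizer of f over Z (0 if there is none). *)
Definition argmin n (Z : set 'cV[R]_n) (f : 'cV[R]_n -> R) : 'cV[R]_n :=
  xget 0 [set z | Z z /\ forall y, Z y -> f z <= f y].

End Euclidean.

Section AMP.
Variables (R : realType) (n : nat).
Local Notation vec := 'cV[R]_n.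
Variables (Z : set vec) (F : vec -> vec) (G : vec -> R).
(* alpha = 0 selects the parameters of the monotone case. *)
Variables (alpha lF lG : R).

(* If lG = 0, the term sqrt (alpha / lG) of the minimum is +oo. *)
Definition amp_alpha (k : nat) : R :=
  if alpha == 0 then 2 / k.+1%:R
  else if lG == 0 then 4^-1 * (alpha / lF)
  else 4^-1 * Num.min (alpha / lF) (Num.sqrt (alpha / lG)).

Definition amp_gamma (k : nat) : R :=
  if alpha == 0 then k%:R / (4 * lG + 3 * k%:R * lF)
  else amp_alpha k / alpha.

Definition amp_prox (g : R) (w u : vec) : vec :=
  argmin Z (fun z => g * dot (z - w) u + 2^-1 * enorm (z - w) ^+ 2).

(* One iteration: from (z_k^ag, w_k) to (z_{k+1}^ag, w_{k+1}). *)
Definition amp_step (k : nat) (s : vec * vec) : vec * vec :=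
  let: (zag, w) := s in
  let a := amp_alpha k in
  let g := amp_gamma k in
  let md := (1 - a) *: zag + a *: w in
  let z' := amp_prox g w (F w + grad G md) in
  let w' := amp_prox g w (F z' + grad G md) in
  ((1 - a) *: zag + a *: z', w').

(* The state after i iterations, i.e. (z_{i+1}^ag, w_{i+1}). *)
Fixpoint amp_iter (x0 : vec) (i : nat) : vec * vec :=
  if i is i'.+1 then amp_step i (amp_iter x0 i') else (x0, x0).

Definition amp_point (x0 : vec) (i : nat) : vec := (amp_iter x0 i).1.

(* Each iteration evaluates F at w_k and z_{k+1} and grad G at z_k^md. *)
Definition amp_evals (i : nat) : nat := 3 * i.

Definition amp_criterion (delta : R) (x : vec) : Prop :=
  forall y, Z y -> G x - G y + dot (x - y) (F y) <= delta.

Definition amp_stops_at (x0 : vec) (delta : R) (i : nat) : Prop :=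
  amp_criterion delta (amp_point x0 i) /\
  forall j, (j < i)%N -> ~ amp_criterion delta (amp_point x0 j).

End AMP.

Record ngnep (R : realType) (N S : nat) := Ngnep {
  dimx : 'I_N -> nat;
  Nset : 'I_S -> {set 'I_N};
  Nset_cover : forall nu, exists s, nu \in Nset s;
  mA : 'I_S -> nat;
  mE : 'I_S -> nat;
  Amx : forall s, 'M[R]_(mA s, \sum_(j < #|Nset s|) dimx (enum_val j));
  bv : forall s, 'cV[R]_(mA s);
  Emx : forall s, 'M[R]_(mE s, \sum_(j < #|Nset s|) dimx (enum_val j));
  dv : forall s, 'cV[R]_(mE s);
  Xhat_ : forall nu, set 'cV[R]_(dimx nu);
  Xhat_convex : forall nu, convex_set (M := 'cV[R]_(dimx nu)) (@Xhat_ nu);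
  Xhat_compact : forall nu, compact (@Xhat_ nu);
  theta : 'I_N -> 'cV[R]_(\sum_(i < N) dimx i) -> R;
  theta_C1 : forall nu, C1 (theta nu)
}.

Arguments Xhat_ {R N S} n nu x.
Arguments theta {R N S} n nu x.

Section NGNEP.
Variables (R : realType) (N S : nat) (P : ngnep R N S).

Definition dim : nat := \sum_(i < N) dimx P i.
Local Notation vec := 'cV[R]_(\sum_(i < N) dimx P i).

Definition Xhat : set vec := [set x | forall nu, Xhat_ P nu (submxcol x nu)].

(* (u; x^{-nu}) *)
Definition deviate (x : vec) (nu : 'I_N) (u : 'cV[R]_(dimx P nu)) : vec :=
  \mxcol_(i < N) dfwith (fun i => submxcol x i) nu u i.

(* x^{N_s} *)
Definition xN (x : vec) (s : 'I_S) :
    'cV[R]_(\sum_(j < #|Nset P s|) dimx P (enum_val j)) :=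
  \mxcol_(j < #|Nset P s|) submxcol x (enum_val j).

Definition ineq_res (x : vec) (s : 'I_S) : 'cV[R]_(mA P s) :=
  Amx P s *m xN x s - bv P s.

Definition eq_res (x : vec) (s : 'I_S) : 'cV[R]_(mE P s) :=
  Emx P s *m xN x s - dv P s.

Definition v_ (nu : 'I_N) (x : vec) : 'cV[R]_(dimx P nu) :=
  submxcol (grad (theta P nu) x) nu.

Definition v (x : vec) : vec := \mxcol_(nu < N) v_ nu x.

Definition player_lipschitz (lth : R) : Prop :=
  forall nu x x', Xhat x -> Xhat x' ->
    enorm (v_ nu x - v_ nu x') <= lth * enorm (x - x').

(* alpha = 0: monotone; alpha > 0: alpha-strongly monotone. *)
Definition ngnep_monotone (alpha : R) : Prop :=
  forall x x', Xhat x -> Xhat x' ->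
    alpha * enorm (x - x') ^+ 2 <= dot (x - x') (v x - v x').

(* Variational KKT point: x is feasible, and (lam, mu) are Lagrange
   multipliers, common to all players, of the linear constraints; the
   constraint x \in Xhat is kept in the variational inequality. *)
Definition is_KKT (x : vec) (lam : forall s, 'cV[R]_(mA P s))
    (mu : forall s, 'cV[R]_(mE P s)) : Prop :=
  [/\ Xhat x,
      forall s i, ineq_res x s i 0 <= 0 /\ 0 <= lam s i 0,
      forall s, eq_res x s = 0,
      forall s, dot (lam s) (ineq_res x s) = 0 &
      forall y, Xhat y ->
        0 <= dot (y - x) (v x)
             + \sum_s (dot (lam s) (Amx P s *m xN (y - x) s)
                       + dot (mu s) (Emx P s *m xN (y - x) s))].

(* Existence of a KKT point whose multipliers have norm at most Lam.  It is
   needed: if the constraints are infeasible, no eps-solution exists for small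
   eps, and if there are no multipliers, a violation of order eps may require
   penalty parameters that grow faster than 1 / eps. *)
Definition KKT_bounded (Lam : R) : Prop :=
  exists x lam mu, is_KKT x lam mu /\
    forall s, enorm (lam s) <= Lam /\ enorm (mu s) <= Lam.

(* Bounds on the remaining problem data on which the O-constants may depend;
   none of them refers to the dimension.  D bounds the diameter of Xhat. *)
Definition data_bounded (D V K : R) : Prop :=
  [/\ forall x y, Xhat x -> Xhat y -> enorm (x - y) <= D,
      forall x, Xhat x -> enorm (v x) <= V &
      forall s, specnorm (Amx P s) <= K /\ specnorm (Emx P s) <= K].

(* The implied constant of the O~(eps) in the definition of an eps-solution is
   C * (1 + log (n + 1) + log (1 / eps)) ^ p. *)
Definition eps_solution (C : R) (p : nat) (eps : R) (x : vec) : Prop :=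
  [/\ Xhat x,
      forall s, enorm (pospart (ineq_res x s)) <= eps /\
                enorm (eq_res x s) <= eps &
      forall nu (u : 'cV[R]_(dimx P nu)), Xhat_ P nu u ->
        (forall s, nu \in Nset P s ->
           enorm (pospart (ineq_res (deviate x u) s)) <= eps /\
           enorm (eq_res (deviate x u) s) <= eps) ->
        dot (submxcol x nu - u) (v_ nu (deviate x u)) <=
          C * (1 + ln dim.+1%:R + ln (1 / eps)) ^+ p * eps].

Definition penalty (beta rho : 'I_S -> R) (x : vec) : R :=
  \sum_s beta s / 2 * enorm (pospart (ineq_res x s)) ^+ 2
  + \sum_s rho s / 2 * enorm (eq_res x s) ^+ 2.

Definition penalty_smoothness (beta rho : 'I_S -> R) : R :=
  \sum_s (beta s * specnorm (Amx P s) ^+ 2 + rho s * specnorm (Emx P s) ^+ 2).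

Section AMPQP.
Variables (alpha lth gamma delta0 : R) (beta0 rho0 : 'I_S -> R) (x0 : vec).

Definition beta_ (k : nat) (s : 'I_S) : R := gamma ^+ k * beta0 s.
Definition rho_ (k : nat) (s : 'I_S) : R := gamma ^+ k * rho0 s.
Definition delta_ (k : nat) : R := delta0 / gamma ^+ k.

(* ampqp_run T x c: the algorithm with T outer iterations outputs x, after c
   gradient evaluations.  Each run of AMP returns the first aggregated point
   that passes the stopping test. *)
Inductive ampqp_run : nat -> vec -> nat -> Prop :=
| ampqp_init : ampqp_run 0 x0 0
| ampqp_next k x c i :
    ampqp_run k x c ->
    let G := penalty (beta_ k.+1) (rho_ k.+1) in
    let lF := Num.sqrt N%:R * lth in
    let lG := penalty_smoothness (beta_ k.+1) (rho_ k.+1) in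
    amp_stops_at Xhat v G alpha lF lG x (delta_ k.+1) i ->
    ampqp_run k.+1 (amp_point Xhat v G alpha lF lG x i) (c + amp_evals i).

(* Some number T of outer iterations makes the algorithm return an
   eps-solution within B gradient evaluations. *)
Definition ampqp_solves (C : R) (p : nat) (eps B : R) : Prop :=
  exists (T : nat) (x : vec) (c : nat),
    [/\ ampqp_run T x c, eps_solution C p eps x & c%:R <= B].

End AMPQP.
End NGNEP.

Arguments Xhat {R N S} P x.
Arguments v {R N S} P x.
Arguments eps_solution {R N S} P C p eps x.
Arguments ampqp_run {R N S} P alpha lth gamma delta0 beta0 rho0 x0 _ _ _.
Arguments ampqp_solves {R N S} P alpha lth gamma delta0 beta0 rho0 x0 C p eps B.

(* Main.v *)
Require Import Defs.
From mathcomp Require Import all_boot all_order all_algebra.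
From mathcomp Require Import all_classical all_reals all_analysis.
From mathcomp Require Import ring lra.

(** For a reference point [z], put [gap z x = G x - G z + <x - z, F z>].  The
    two prox inequalities of an AMP iteration, added with the descent inequality
    for [G] at the extrapolated point, give a recursion for [gap z]: it decays
    like [lG D^2 / k^2 + lF D^2 / k] in the monotone case, and geometrically
    with ratio [1 - a], [1 / a ~ lF / alpha + sqrt (lG / alpha)], in the strongly
    monotone case.  With [lG ~ gamma^k] and [delta_k ~ gamma^-k] the [k]-th run
    thus takes [O(gamma^k)], resp. [O(k gamma^(k/2))], iterations, and the sum is
    dominated by the last run.

    At termination the multipliers [(lam, mu)] of a KKT point bound the penalty
    by [delta + Lam * sum of residuals]; as the penalty is quadratic with
    coefficient of order [gamma^T], the residuals are [O(gamma^-T)].  Testing the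
    stopping criterion against a unilateral deviation that is eps-feasible gives
    [delta + O(gamma^T eps^2)].  Both are [O(eps)] once [gamma^T ~ 1 / eps]. *)

Set Implicit Arguments.
Unset Strict Implicit.
Unset Printing Implicit Defensive.

Import Order.TTheory GRing.Theory Num.Theory.
Import numFieldNormedType.Exports.

Local Open Scope classical_set_scope.
Local Open Scope ring_scope.

(** * Euclidean geometry of column vectors and the spectral norm *)

Section EuclideanSpace.
Variables (R : realType).
Implicit Types n : nat.

Lemma dotC n (x y : 'cV[R]_n) : dot x y = dot y x.
Proof. by apply: eq_bigr => i _; rewrite mulrC. Qed.

Lemma dotDl n (x y z : 'cV[R]_n) : dot (x + y) z = dot x z + dot y z.
Proof. by rewrite -big_split; apply: eq_bigr => i _; rewrite !mxE mulrDl. Qed.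

Lemma dotNl n (x z : 'cV[R]_n) : dot (- x) z = - dot x z.
Proof. by rewrite -sumrN; apply: eq_bigr => i _; rewrite !mxE mulNr. Qed.

Lemma dotZl n a (x z : 'cV[R]_n) : dot (a *: x) z = a * dot x z.
Proof. by rewrite mulr_sumr; apply: eq_bigr => i _; rewrite !mxE mulrA. Qed.

Lemma dotDr n (x y z : 'cV[R]_n) : dot z (x + y) = dot z x + dot z y.
Proof. by rewrite dotC dotDl !(dotC z). Qed.

Lemma dotNr n (x z : 'cV[R]_n) : dot z (- x) = - dot z x.
Proof. by rewrite dotC dotNl dotC. Qed.

Lemma dotZr n a (x z : 'cV[R]_n) : dot z (a *: x) = a * dot z x.
Proof. by rewrite dotC dotZl dotC. Qed.

Lemma dotBr n (x y z : 'cV[R]_n) : dot z (x - y) = dot z x - dot z y.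
Proof. by rewrite dotDr dotNr. Qed.

Lemma dot0l n (x : 'cV[R]_n) : dot 0 x = 0.
Proof. by rewrite -(scale0r x) dotZl mul0r. Qed.

Lemma dot0r n (x : 'cV[R]_n) : dot x 0 = 0.
Proof. by rewrite dotC dot0l. Qed.

Definition dotE :=
  (dotDl, dotDr, dotNl, dotNr, dotZl, dotZr, dot0l, dot0r).

Lemma dotxx_ge0 n (x : 'cV[R]_n) : 0 <= dot x x.
Proof. by apply: sumr_ge0 => i _; rewrite -expr2 sqr_ge0. Qed.

Lemma dotxx_eq0 n (x : 'cV[R]_n) : dot x x = 0 -> x = 0.
Proof.
move=> /eqP; rewrite psumr_eq0 => [/allP x0|i _]; last by rewrite -expr2 sqr_ge0.
apply/colP => i; have := x0 i; rewrite mem_index_enum => /(_ isT).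
by rewrite !mxE /= mulf_eq0 orbb => /eqP.
Qed.

Lemma sqr_enorm n (x : 'cV[R]_n) : enorm x ^+ 2 = dot x x.
Proof. by rewrite sqr_sqrtr // dotxx_ge0. Qed.

Lemma enorm_ge0 n (x : 'cV[R]_n) : 0 <= enorm x.
Proof. exact: sqrtr_ge0. Qed.

Lemma enorm0 n : enorm (0 : 'cV[R]_n) = 0.
Proof. by rewrite /enorm dot0l sqrtr0. Qed.

Lemma enormZ n a (x : 'cV[R]_n) : enorm (a *: x) = `|a| * enorm x.
Proof.
by rewrite /enorm dotZl dotZr mulrA -expr2 sqrtrM ?sqr_ge0 // sqrtr_sqr.
Qed.

Lemma enorm_eq0 n (x : 'cV[R]_n) : enorm x = 0 -> x = 0.
Proof. by move=> x0; apply: dotxx_eq0; rewrite -sqr_enorm x0 expr0n. Qed.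

Lemma ler_enorm n (x : 'cV[R]_n) c : 0 <= c -> (enorm x <= c) = (dot x x <= c ^+ 2).
Proof. by move=> c0; rewrite -sqr_enorm ler_sqr // nnegrE enorm_ge0. Qed.

Lemma cauchy_schwarz n (x y : 'cV[R]_n) : dot x y <= enorm x * enorm y.
Proof.
have := dotxx_ge0 (enorm y *: x - enorm x *: y).
rewrite !dotE -!sqr_enorm (dotC y x) => h.
have := enorm_ge0 x; rewrite le_eqVlt => /orP[/eqP x0|x0].
  by rewrite (enorm_eq0 (esym x0)) dot0l enorm0 mul0r.
have := enorm_ge0 y; rewrite le_eqVlt => /orP[/eqP y0|y0].
  by rewrite (enorm_eq0 (esym y0)) dot0r enorm0 mulr0.
rewrite -(ler_pM2l (mulr_gt0 x0 y0)).
nra.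
Qed.

Lemma dot_mulmx m n (A : 'M[R]_(m, n)) (x : 'cV[R]_n) i :
  (A *m x) i 0 = dot (row i A)^T x.
Proof. by rewrite mxE; apply: eq_bigr => j _; rewrite !mxE. Qed.

(** A [sup] carries information only for bounded sets. Cauchy-Schwarz on each row bounds the set by
    the Frobenius norm. *)
Lemma specnorm_ubound m n (A : 'M[R]_(m, n)) :
  has_ubound [set enorm (A *m u) | u in [set u : 'cV[R]_n | enorm u <= 1]].
Proof.
exists (Num.sqrt (\sum_i dot (row i A)^T (row i A)^T)) => _ /= [u u1 <-].
rewrite ler_wsqrtr //; apply: ler_sum => i _; rewrite dot_mulmx -expr2.
(* Cauchy-Schwarz is one-sided here, so a negative entry is treated through the opposite row. *)
have [d0|d0] := leP 0 (dot (row i A)^T u); last first.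
  have := cauchy_schwarz (- (row i A)^T) u; rewrite dotNl => h.
  have eN : enorm (- (row i A)^T) = enorm (row i A)^T.
    by rewrite -scaleN1r enormZ normrN1 mul1r.
  rewrite -sqr_enorm -ler_sqrt ?sqr_ge0 // !sqrtr_sqr ltr0_norm // ger0_norm ?enorm_ge0 //.
  by rewrite (le_trans h) // eN ler_piMr // enorm_ge0.
rewrite -sqr_enorm ler_sqr ?nnegrE ?enorm_ge0 //.
by rewrite (le_trans (cauchy_schwarz _ _)) // ler_piMr // enorm_ge0.
Qed.

Lemma enorm_mulmx m n (A : 'M[R]_(m, n)) u : enorm (A *m u) <= specnorm A * enorm u.
Proof.
have [u0|u0] := eqVneq (enorm u) 0.
  by rewrite (enorm_eq0 u0) mulmx0 !enorm0 mulr0.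
have ugt : 0 < enorm u by rewrite lt_def u0 enorm_ge0.
rewrite -ler_pdivrMr //.
have -> : enorm (A *m u) / enorm u = enorm (A *m ((enorm u)^-1 *: u)).
  by rewrite -scalemxAr enormZ mulrC ger0_norm // invr_ge0 ltW.
apply: ub_le_sup; first exact: specnorm_ubound.
by exists ((enorm u)^-1 *: u) => //=; rewrite enormZ ger0_norm ?invr_ge0 ?enorm_ge0 // mulVf.
Qed.

Lemma specnorm_ge0 m n (A : 'M[R]_(m, n)) : 0 <= specnorm A.
Proof.
apply: ub_le_sup; first exact: specnorm_ubound.
by exists 0 => /=; rewrite ?mulmx0 enorm0 ?ler01.
Qed.

Lemma dot_mulmx_le m n (A : 'M[R]_(m, n)) u :
  dot (A *m u) (A *m u) <= specnorm A ^+ 2 * dot u u.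
Proof.
by rewrite -!sqr_enorm -exprMn ler_sqr ?nnegrE ?mulr_ge0 ?enorm_ge0 ?specnorm_ge0 // enorm_mulmx.
Qed.

Lemma dot_mxcol k (p : 'I_k -> nat) (x y : 'cV[R]_(\sum_(i < k) p i)) :
  dot x y = \sum_i dot (submxcol x i) (submxcol y i).
Proof.
have dotE' n (a b : 'cV[R]_n) : dot a b = (a^T *m b) 0 0.
  by rewrite mxE; apply: eq_bigr => i _; rewrite !mxE.
rewrite dotE' -{1}(submxcolK x) -{1}(submxcolK y) tr_mxcol mul_mxrow_mxcol.
by rewrite summxE; apply: eq_bigr => i _; rewrite dotE'.
Qed.

End EuclideanSpace.

(** * Gradients identified from quadratic error bounds *)

Section Gradient.
Variables (R : realType) (n : nat).
Local Notation vec := 'cV[R]_n.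

(* The error bound [c t^2] replaces differentiation rules: it is what the
   quadratic penalty satisfies although [pospart] is not differentiable. *)
Lemma derive_of_quadratic_error (f : vec -> R) (x d : vec) l c :
  (forall t, `|f (t *: d + x) - f x - t * l| <= c * t ^+ 2) -> 'D_d f x = l.
Proof.
move=> h; apply: cvg_lim; first exact: Rhausdorff.
apply/cvgrPdist_le => /= e e0.
have c1 : 0 < `|c| + 1 by rewrite ltr_wpDl.
near=> t.
have t0 : t != 0 by near: t; exact: nbhs_dnbhs_neq.
have tle : `|t| < e / (`|c| + 1) by near: t; apply: dnbhs0_lt; rewrite divr_gt0.
rewrite /GRing.scale /= distrC.
have -> : t^-1 * (f (t *: d + x) - f x) - l = t^-1 * (f (t *: d + x) - f x - t * l).
  by rewrite [RHS]mulrBr mulKf.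
rewrite normrM normfV ler_pdivrMl ?normr_gt0 // (le_trans (h t)) //.
rewrite -real_normK ?num_real // expr2 mulrCA ler_pM2l ?normr_gt0 //.
move: tle; rewrite ltr_pdivlMr // => tle.
apply: le_trans (ltW tle); rewrite mulrC ler_wpM2l //.
by rewrite (le_trans (ler_norm c)) // lerDl.
Unshelve. all: by end_near. Qed.

Lemma linear_functional_dot (L : vec -> R) :
  (forall a x y, L (a *: x + y) = a * L x + L y) ->
  forall h, L h = dot (\col_i L (delta_mx i 0)) h.
Proof.
move=> linL h.
have L0 : L 0 = 0 by have := linL (-1) 0 0; rewrite scaler0 addr0 mulN1r addNr.
have LD : {morph L : x y / x + y} by move=> x y; rewrite -[x]scale1r linL mul1r scale1r.
rewrite {1}(matrix_sum_delta h) (big_morph L LD L0); apply: eq_bigr => i _.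
by rewrite big_ord1 -[_ *: _]addr0 linL L0 addr0 !mxE mulrC.
Qed.

(** Restricted to a coordinate axis the error is quadratic in [t], so each partial derivative is the
    value of [L] on a basis vector; linearity does the rest. *)
Lemma dot_grad (f : vec -> R) (x : vec) (L : vec -> R) c :
  (forall a y z, L (a *: y + z) = a * L y + L z) ->
  (forall h, `|f (h + x) - f x - L h| <= c * dot h h) ->
  forall h, dot (grad f x) h = L h.
Proof.
move=> linL hL h; rewrite (linear_functional_dot linL).
congr dot; apply/colP => i; rewrite !mxE.
apply: (@derive_of_quadratic_error _ _ _ _ (c * dot (delta_mx i 0) (delta_mx i 0))) => t.
have L0 : L 0 = 0 by have := linL (-1) 0 0; rewrite scaler0 addr0 mulN1r addNr.
have := hL (t *: delta_mx i 0).
rewrite -[in L _](addr0 (t *: _)) linL L0 addr0 !dotE => /le_trans; apply.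
by rewrite le_eqVlt; apply/orP; left; apply/eqP; ring.
Qed.

End Gradient.

(** * The proximal step and its optimality inequality *)

Section Prox.
Variables (R : realType) (n : nat).
Local Notation vec := 'cV[R]_n.
Implicit Types (Z : set vec) (w u x y z : vec) (g : R).

Definition prox_obj g w u z : R := g * dot (z - w) u + 2^-1 * enorm (z - w) ^+ 2.

(** [argmin] returns the default [0] when there is no minimizer, so this existence is what places
    [amp_prox] in [Z]. *)
Definition proximinal Z := forall g w u,
  exists z, Z z /\ forall y, Z y -> prox_obj g w u z <= prox_obj g w u y.

Definition convex_subset Z := forall x y t,
  Z x -> Z y -> 0 <= t -> t <= 1 -> Z ((1 - t) *: x + t *: y).

Lemma amp_proxP Z g w u : proximinal Z ->
  Z (amp_prox Z g w u) /\
  forall y, Z y -> prox_obj g w u (amp_prox Z g w u) <= prox_obj g w u y.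
Proof. by move=> pZ; exact: (xgetPex 0 (pZ g w u)). Qed.

(** If [L] were negative, the point [t = - L / (q - L)] of the unit interval would give the value
    [- t * L ^+ 2 / (q - L) < 0]. *)
Lemma ge0_of_quadratic (L q : R) : 0 <= q ->
  (forall t, 0 <= t -> t <= 1 -> 0 <= t * L + t ^+ 2 * q) -> 0 <= L.
Proof.
move=> q0 h; rewrite leNgt; apply/negP => L0.
have qL : 0 < q - L by lra.
have t0 : 0 < - L / (q - L) by rewrite divr_gt0 //; lra.
have /h : 0 <= - L / (q - L) by exact: ltW.
rewrite ler_pdivrMr // => /(_ ltac:(lra)).
have -> : - L / (q - L) * L + (- L / (q - L)) ^+ 2 * q =
          - (- L / (q - L) * (L ^+ 2 / (q - L))) by field; rewrite gt_eqF.
by rewrite oppr_ge0 leNgt mulr_gt0 // divr_gt0 // exprn_even_gt0 //= lt_eqF.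
Qed.

(** First-order optimality of [p] along the segment towards [z]; polarization then turns the inner
    product of [p - w] and [z - p] into squared distances. *)
Lemma amp_prox_three_point Z g w u p z : convex_subset Z -> proximinal Z -> Z z ->
  p = amp_prox Z g w u ->
  g * dot (p - z) u <= 2^-1 * (dot (z - w) (z - w) - dot (p - w) (p - w)
                               - dot (p - z) (p - z)).
Proof.
move=> cZ pZ Zz ->; have [] := amp_proxP g w u pZ.
move: (amp_prox Z g w u) => {}p Zp minp.
have expand t : prox_obj g w u ((1 - t) *: p + t *: z) - prox_obj g w u p =
    t * (dot (z - p) (g *: u + (p - w))) + t ^+ 2 * (2^-1 * dot (z - p) (z - p)).
  rewrite /prox_obj !sqr_enorm !dotE (dotC p z) (dotC w z) (dotC w p).
  by field.
have Lge0 : 0 <= dot (z - p) (g *: u + (p - w)).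
  apply: (@ge0_of_quadratic _ (2^-1 * dot (z - p) (z - p))) => [|t t0 t1].
    by rewrite mulr_ge0 ?dotxx_ge0 // invr_ge0 ler0n.
  by rewrite -expand subr_ge0; apply: minp; exact: cZ.
move: Lge0; rewrite !dotE (dotC p z) (dotC w z) (dotC w p) => h.
by lra.
Qed.

End Prox.

(** * Gap recursions for AMP *)

Section AMPConvergence.
Variables (R : realType) (n : nat).
Local Notation vec := 'cV[R]_n.

Definition smooth_convex (G : vec -> R) (lG : R) := forall x y,
  G x + dot (grad G x) (y - x) <= G y /\
  G y <= G x + dot (grad G x) (y - x) + lG / 2 * dot (y - x) (y - x).

Variables (Z : set vec) (F : vec -> vec) (G : vec -> R) (alpha lF lG D : R).
Hypotheses (cZ : convex_subset Z) (pZ : proximinal Z).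
Hypothesis lipF : forall x y, Z x -> Z y ->
  dot (F x - F y) (F x - F y) <= lF ^+ 2 * dot (x - y) (x - y).
Hypothesis monF : forall x y, Z x -> Z y ->
  alpha * dot (x - y) (x - y) <= dot (x - y) (F x - F y).
Hypothesis scG : smooth_convex G lG.
Hypothesis lG_ge0 : 0 <= lG.
Hypothesis diamZ : forall x y, Z x -> Z y -> dot (x - y) (x - y) <= D ^+ 2.

(** The three-point inequality is applied to [z'] tested at [w'] and to [w'] tested at [z]. The
    mismatch between [F z'] and [F w] is split by Young's inequality: one part cancels the squared
    distance from [z'] to [w'], the other costs [g ^+ 2 * lF ^+ 2]. *)
Lemma extragradient_step g (w z h z' w' : vec) : Z w -> Z z ->
  z' = amp_prox Z g w (F w + h) -> w' = amp_prox Z g w (F z' + h) ->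
  g * dot (z' - z) (F z' + h) <=
  2^-1 * (dot (z - w) (z - w) - dot (z - w') (z - w')
          - (1 - g ^+ 2 * lF ^+ 2) * dot (z' - w) (z' - w)).
Proof.
move=> Zw Zz ez ew.
have Zz' : Z z' by rewrite ez; exact: (amp_proxP _ _ _ pZ).1.
have Zw' : Z w' by rewrite ew; exact: (amp_proxP _ _ _ pZ).1.
have p1 := amp_prox_three_point cZ pZ Zw' ez.
have p2 := amp_prox_three_point cZ pZ Zz ew.
have lip := lipF Zz' Zw.
have sq (a b : vec) : 0 <= g ^+ 2 * dot a a - 2 * g * dot a b + dot b b :> R.
  have := dotxx_ge0 (g *: a - b); rewrite !dotE (dotC b a) => h'.
  by lra.
have {}sq := sq (F z' - F w) (z' - w').
have glip : g ^+ 2 * dot (F z' - F w) (F z' - F w) <=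
    g ^+ 2 * (lF ^+ 2 * dot (z' - w) (z' - w)) by rewrite ler_wpM2l ?sqr_ge0.
have -> : dot (z' - z) (F z' + h) = dot (z' - w') (F w + h)
    + dot (F z' - F w) (z' - w') + dot (w' - z) (F z' + h).
  by rewrite (dotC (F z' - F w)) !dotE; ring.
have -> : dot (z - w') (z - w') = dot (w' - z) (w' - z).
  by rewrite !dotE; ring.
lra.
Qed.

(** The new aggregated point differs from [md] by [a *: (z' - w)], so the smoothness term gains the
    factor [a ^+ 2]; convexity at [zag] and at [z] handles the linear part. *)
Lemma descent_step a zag w md z z' : 0 <= a -> a <= 1 ->
  md = (1 - a) *: zag + a *: w ->
  G ((1 - a) *: zag + a *: z') <=
  (1 - a) * G zag + a * G z + a * dot (z' - z) (grad G md)
  + lG / 2 * (a ^+ 2 * dot (z' - w) (z' - w)).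
Proof.
move=> a0 a1 emd.
have [_] := scG md ((1 - a) *: zag + a *: z').
have -> : (1 - a) *: zag + a *: z' - md = a *: (z' - w).
  by rewrite emd opprD addrACA addrN add0r scalerBr.
have [czag _] := scG md zag; have [cz _] := scG md z.
rewrite !(dotZl, dotZr).
have {}czag : (1 - a) * (G md + dot (grad G md) (zag - md)) <= (1 - a) * G zag.
  by rewrite ler_wpM2l // subr_ge0.
have {}cz : a * (G md + dot (grad G md) (z - md)) <= a * G z by rewrite ler_wpM2l.
have -> : a * dot (grad G md) (z' - w) = (1 - a) * dot (grad G md) (zag - md)
    + a * dot (grad G md) (z - md) + a * dot (z' - z) (grad G md).
  by rewrite (dotC (z' - z)) {3 5}emd !dotE; ring.
rewrite !mulrDr in czag cz.
lra.
Qed.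

Definition gap z x := G x - G z + dot (x - z) (F z).

(** Monotonicity trades [F z], which the gap contains, for [F z'], which the extragradient
    inequality controls. *)
Lemma gap_step a zag w md z z' : 0 <= a -> a <= 1 -> Z z -> Z z' ->
  md = (1 - a) *: zag + a *: w ->
  gap z ((1 - a) *: zag + a *: z') <=
  (1 - a) * gap z zag + a * dot (z' - z) (F z' + grad G md)
  - a * alpha * dot (z' - z) (z' - z)
  + lG / 2 * (a ^+ 2 * dot (z' - w) (z' - w)).
Proof.
move=> a0 a1 Zz Zz' emd.
have := descent_step z z' a0 a1 emd.
have mon : a * (alpha * dot (z' - z) (z' - z)) <= a * dot (z' - z) (F z' - F z).
  by rewrite ler_wpM2l // monF.
rewrite /gap (dotDr (F z')) => desc.
have -> : dot ((1 - a) *: zag + a *: z' - z) (F z) =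
    (1 - a) * dot (zag - z) (F z) + a * dot (z' - z) (F z).
  by rewrite !dotE; ring.
rewrite (dotBr _ (F z)) in mon.
lra.
Qed.

Local Notation iter_ := (amp_iter Z F G alpha lF lG).
Local Notation a_ := (amp_alpha alpha lF lG).
Local Notation g_ := (amp_gamma alpha lF lG).

(** Steps are numbered from 1, hence [a_ k.+1]: in the monotone case [a_ 0 = 2] would leave the unit
    interval. *)
Lemma amp_iter_in x0 : Z x0 -> (forall k, 0 <= a_ k.+1 /\ a_ k.+1 <= 1) ->
  forall i, Z (iter_ x0 i).1 /\ Z (iter_ x0 i).2.
Proof.
move=> Zx0 a01; elim=> [//|i] /=; rewrite /amp_step.
case: (iter_ x0 i) => zag w /= [Zzag Zw]; have [a0 a1] := a01 i.
by split; [apply: cZ => //|]; exact: (amp_proxP _ _ _ pZ).1.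
Qed.

Lemma amp_criterion_gap x0 i e :
  (forall z, Z z -> gap z (iter_ x0 i).1 <= e) ->
  amp_criterion Z F G e (amp_point Z F G alpha lF lG x0 i).
Proof. by []. Qed.

(* The weights [i (i + 1)] make [(1 - a_i) i (i + 1) = (i - 1) i], so that the
   gap recursion telescopes. *)
Lemma amp_monotone_gap x0 z i : alpha = 0 -> 0 < lF -> Z x0 -> Z z ->
  i%:R * i.+1%:R * gap z (iter_ x0 i).1
  + (4 * lG + 3 * i%:R * lF) * dot (z - (iter_ x0 i).2) (z - (iter_ x0 i).2)
  <= (4 * lG + 3 * i%:R * lF) * D ^+ 2.
Proof.
move=> alpha0 lF0 Zx0 Zz.
have a01 k : 0 <= a_ k.+1 /\ a_ k.+1 <= 1.
  rewrite /amp_alpha alpha0 eqxx; split; first by rewrite divr_ge0.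
  by rewrite ler_pdivrMr ?ltr0n // mul1r ler_nat.
have inZ := amp_iter_in Zx0 a01.
elim: i => [|i IH].
  by rewrite !mul0r add0r ler_wpM2l ?diamZ //= mulr0 mul0r addr0 mulr_ge0.
have [Zzag Zw] := inZ i; have [] := inZ i.+1; move: IH.
rewrite /= /amp_step; case: (iter_ x0 i) Zzag Zw => zag w /= Zzag Zw IH.
have [] := a01 i; set a := a_ i.+1; set g := g_ i.+1 => a0 a1.
set md := (1 - a) *: zag + a *: w.
set z' := amp_prox Z g w (F w + _); set w' := amp_prox Z g w (F z' + _) => _ Zw'.
have Zz' : Z z' by exact: (amp_proxP _ _ _ pZ).1.
have eg := extragradient_step Zw Zz (erefl z') (erefl w').
have := gap_step a0 a1 Zz Zz' (erefl md); rewrite alpha0 mulr0 mul0r subr0 => gs.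
have dzw := diamZ Zz Zw.
pose k : R := i.+1%:R; pose E := 4 * lG + 3 * k * lF.
have k0 : 1 <= k by rewrite ler1n.
have E0 : 0 < E by rewrite ltr_wpDl ?mulr_ge0 // !mulr_gt0 // (lt_le_trans ltr01).
have i1 : i%:R = k - 1 by rewrite /k -natr1 addrK.
have i2 : i.+2%:R = k + 1 by rewrite /k -natr1.
have ak : a * (k + 1) = 2 by rewrite /a /amp_alpha alpha0 eqxx i2 divfK // gt_eqF //; lra.
have gE : g * E = k by rewrite /g /amp_gamma alpha0 eqxx divfK // gt_eqF.
have a2 : a * k <= 2 by rewrite -ak ler_wpM2l //; lra.
have g0 : 0 <= g by rewrite -(pmulr_lge0 _ E0) gE; lra.
(* From [g * E = k] and [E >= 3 * k * lF]. *)
have glF : g * lF <= 3^-1.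
  rewrite -(ler_pM2r (mulr_gt0 (ltr0Sn R 2) (lt_le_trans ltr01 k0))).
  by move: (mulr_ge0 g0 lG_ge0) gE; rewrite /E; lra.
move: IH; rewrite -/k -/E i1 i2.
move: gs eg; set dq := dot (z' - z) _; set q := dot (z' - w) _ => gs eg IH.
set d0 := dot (z - w) _ in dzw eg IH *; set d1 := dot (z - w') _ in eg *.
have q0 : 0 <= q by exact: dotxx_ge0.
have kgs := ler_wpM2l (mulr_ge0 (le_trans ler01 k0) (addr_ge0 (le_trans ler01 k0) ler01)) gs.
have Eeg := ler_wpM2l (ltW E0) eg.
(* The weight of the distance term grows by [3 * lF] per iteration; the diameter pays for it, whence
   the term linear in [i] on the right-hand side. *)
have lFd : lF * d0 <= lF * D ^+ 2 by rewrite ler_wpM2l // ltW.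
have E1 : k * (k + 1) * ((1 - a) * gap z zag + a * dq + lG / 2 * (a ^+ 2 * q)) =
   k * (k - 1) * gap z zag + 2 * (E * (g * dq)) + lG * (a * k) * q.
  have -> : E * (g * dq) = k * dq by rewrite -gE; ring.
  have -> : k * (k - 1) = k * (k + 1) - k * (a * (k + 1)) by rewrite ak; ring.
  have -> : 2 * (k * dq) = (a * (k + 1)) * (k * dq) by rewrite ak.
  have -> : lG * (a * k) = (a * (k + 1)) * (lG / 2 * a * k) by rewrite ak; field.
  by ring.
(* The constants 4 and 3 in [E] serve here: the positive terms are at most [2 * lG] and
   [k * lF / 3]. *)
have qc : lG * (a * k) + E * (g ^+ 2 * lF ^+ 2) - E <= 0.
  have -> : E * (g ^+ 2 * lF ^+ 2) = (g * lF) * (k * lF) by rewrite -gE; ring.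
  have := ler_wpM2l lG_ge0 a2.
  have := ler_wpM2r (mulr_ge0 (le_trans ler01 k0) (ltW lF0)) glF.
  have := mulr_ge0 (le_trans ler01 k0) (ltW lF0).
  by move: lG_ge0; rewrite /E; lra.
have := ler_wpM2r q0 qc; rewrite mul0r => {}qc.
rewrite E1 in kgs; rewrite /E in qc Eeg kgs *.
lra.
Qed.

(** Each term of the minimum defining the step size yields one of the product bounds, and the
    inverse of a minimum is at most the sum of the inverses. *)
Lemma amp_alpha_strong k : 0 < alpha -> alpha <= lF ->
  [/\ 0 < a_ k, a_ k * lF <= alpha / 4, lG * a_ k ^+ 2 <= alpha / 16 &
      (a_ k)^-1 <= 4 * (lF / alpha + Num.sqrt (lG / alpha))].
Proof.
move=> al0 allF; have lF0 := lt_le_trans al0 allF.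
have i4 : 0 <= 4^-1 :> R by rewrite invr_ge0.
have m0 : 0 < alpha / lF by rewrite divr_gt0.
have inv_m : (4^-1 * (alpha / lF))^-1 = 4 * (lF / alpha) by rewrite invfM invrK invf_div.
rewrite /amp_alpha gt_eqF //; have [->|lGn0] := eqVneq lG 0.
  split; first by rewrite mulr_gt0 // invr_gt0.
  - by rewrite -mulrA divfK ?gt_eqF // mulrC.
  - by rewrite mul0r divr_ge0 // ltW.
  - by rewrite inv_m mul0r sqrtr0 addr0.
have lG0 : 0 < lG by rewrite lt_def lGn0 lG_ge0.
set s := Num.sqrt (alpha / lG).
have s0 : 0 < s by rewrite sqrtr_gt0 divr_gt0.
have s2 : s ^+ 2 = alpha / lG by rewrite sqr_sqrtr // ltW // divr_gt0.
have inv_s : (4^-1 * s)^-1 = 4 * Num.sqrt (lG / alpha).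
  by rewrite invfM invrK /s -sqrtrV ?invf_div // divr_ge0 // ltW.
have mle : 4^-1 * Num.min (alpha / lF) s <= 4^-1 * (alpha / lF).
  by rewrite ler_wpM2l // ge_min lexx.
have sle : 4^-1 * Num.min (alpha / lF) s <= 4^-1 * s.
  by rewrite ler_wpM2l // ge_min lexx orbT.
have a0 : 0 < 4^-1 * Num.min (alpha / lF) s by rewrite mulr_gt0 ?invr_gt0 // lt_min m0 s0.
split => //.
- apply: (le_trans (ler_wpM2r (ltW lF0) mle)).
  by rewrite -mulrA divfK ?gt_eqF // mulrC.
- have : (4^-1 * Num.min (alpha / lF) s) ^+ 2 <= (4^-1 * s) ^+ 2.
    by rewrite ler_sqr ?nnegrE ?(ltW a0) // mulr_ge0 // ltW.
  rewrite [leRHS]exprMn s2 => /(ler_wpM2l (ltW lG0)) /le_trans; apply.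
  by rewrite le_eqVlt; apply/orP; left; apply/eqP; field; rewrite gt_eqF.
- case: (leP (alpha / lF) s) => _; first by rewrite inv_m ler_wpM2l // lerDl sqrtr_ge0.
  by rewrite inv_s ler_wpM2l // lerDr divr_ge0 // ltW.
Qed.

(** The gap plus [alpha / 2] times the squared distance to [w] is a Lyapunov function. The gain from
    strong monotonicity is at [z'], not at [w]; [par] moves it to [w] at the price of the squared
    distance from [z'] to [w]. *)
Lemma amp_strong_gap x0 z i : 0 < alpha -> alpha <= lF -> Z x0 -> Z z ->
  gap z (iter_ x0 i).1 + alpha / 2 * dot (z - (iter_ x0 i).2) (z - (iter_ x0 i).2)
  <= (1 - a_ 1) ^+ i * (gap z x0 + alpha / 2 * dot (z - x0) (z - x0)).
Proof.
move=> al0 allF Zx0 Zz.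
have a_const k : a_ k = a_ 1 by rewrite /amp_alpha gt_eqF.
have [a0 alF alG _] := amp_alpha_strong 1 al0 allF.
have a4 : a_ 1 <= 4^-1.
  rewrite -(ler_pM2r (lt_le_trans al0 allF)) (le_trans alF) // mulrC ler_wpM2l //.
have a01 k : 0 <= a_ k.+1 /\ a_ k.+1 <= 1 by rewrite a_const; split; lra.
have inZ := amp_iter_in Zx0 a01.
elim: i => [|i IH]; first by rewrite expr0 mul1r.
have [Zzag Zw] := inZ i; have [] := inZ i.+1; move: IH.
rewrite /= /amp_step /amp_gamma (a_const i.+1) gt_eqF //.
case: (iter_ x0 i) Zzag Zw => zag w /= Zzag Zw IH.
set a := a_ 1 in a0 alF alG a4 IH *; set g := a / alpha.
set md := (1 - a) *: zag + a *: w.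
set z' := amp_prox Z g w (F w + _); set w' := amp_prox Z g w (F z' + _) => _ Zw'.
have Zz' : Z z' by exact: (amp_proxP _ _ _ pZ).1.
have eg := extragradient_step Zw Zz (erefl z') (erefl w').
have a1 : a <= 1 by lra.
have gs := gap_step (ltW a0) a1 Zz Zz' (erefl md).
have ag : alpha * g = a by rewrite /g mulrC divfK // gt_eqF.
have glF : g ^+ 2 * lF ^+ 2 <= 16^-1.
  have : g * lF <= 4^-1 by rewrite -(ler_pM2l al0) mulrA ag.
  have : 0 <= g * lF by exact: mulr_ge0 (divr_ge0 (ltW a0) (ltW al0)) (le_trans (ltW al0) allF).
  by rewrite -exprMn expr2; nra.
have par : dot (z - w) (z - w) <= 2 * dot (z' - z) (z' - z) + 2 * dot (z' - w) (z' - w).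
  have := dotxx_ge0 (z' - z + (z' - w)); rewrite !dotE (dotC w z) (dotC z' z) (dotC z' w).
  by lra.
rewrite exprS -(mulrA (1 - a)).
have {}IH := ler_wpM2l (ltac:(lra) : 0 <= 1 - a) IH; apply: le_trans _ IH.
have q0 := dotxx_ge0 (z' - w).
have {}eg := ler_wpM2l (ltW al0) eg; rewrite mulrA ag in eg.
have {}glF := ler_wpM2l (mulr_ge0 (ltW al0) q0) glF.
have {}par := ler_wpM2l (mulr_ge0 (ltW al0) (ltW a0)) par.
have {}a4 := ler_wpM2l (mulr_ge0 (ltW al0) q0) a4.
have {}alG := ler_wpM2r q0 alG.
(* The squared distance from [z'] to [w] is left with a coefficient of at most
   [alpha * (- 15 / 32 + 1 / 4 + 1 / 32) < 0]. *)
have := mulr_ge0 (ltW al0) q0.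
lra.
Qed.

End AMPConvergence.

(** * Block structure and the product strategy set *)

Section Players.
Variables (R : realType) (N S : nat) (P : ngnep R N S).
Local Notation vec := 'cV[R]_(\sum_(i < N) dimx P i).
Implicit Types (x y h : vec) (s : 'I_S).

Lemma submxcolZ (k m : nat) (p : 'I_k -> nat) a (x : 'M[R]_(\sum_(i < k) p i, m)) i :
  submxcol (a *: x) i = a *: submxcol x i.
Proof. by apply/matrixP => j l; rewrite !mxE. Qed.

Lemma xN_linear a x y s : xN (a *: x + y) s = a *: xN x s + xN y s.
Proof.
by apply/mxcolP => j; rewrite /xN mxcolK !submxcolD !submxcolZ !mxcolK.
Qed.

(** [xN] keeps some of the blocks, each once, so the smoothness constant of the penalty needs no
    factor counting players. *)
Lemma dot_xN_le h s : dot (xN h s) (xN h s) <= dot h h.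
Proof.
have -> : dot (xN h s) (xN h s) = \sum_(i in Nset P s) dot (submxcol h i) (submxcol h i).
  rewrite dot_mxcol [RHS]big_enum_val; apply: eq_bigr => j _.
  by rewrite /xN !mxcolK.
rewrite dot_mxcol [leRHS](bigID (mem (Nset P s))) /= lerDl.
by apply: sumr_ge0 => i _; exact: dotxx_ge0.
Qed.

Lemma Xhat_mxcol (f : forall i, 'cV[R]_(dimx P i)) :
  (forall i, Xhat_ P i (f i)) -> Xhat P (\mxcol_i f i).
Proof. by move=> fX i; rewrite mxcolK. Qed.

Lemma Xhat_convex_subset : convex_subset (Xhat P).
Proof.
move=> x y t Xx Xy t0 t1 i; rewrite submxcolD !submxcolZ.
have s0 : 0 <= 1 - t by lra.
have s1 : 1 - t <= 1 by lra.
(* The convex combination of parameter [1 - t] has [1 - (1 - t)] as its second weight. *)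
rewrite -[X in _ + X *: _](subKr 1 t); apply: set_mem.
exact: (@Xhat_convex _ _ _ P i (submxcol x i) (submxcol y i) (Itv01 s0 s1)
  (mem_set (Xx i)) (mem_set (Xy i))).
Qed.

Lemma continuous_sum (T : topologicalType) (I : Type) (r : seq I) (F : I -> T -> R) :
  (forall i, continuous (F i)) -> continuous (fun z => \sum_(i <- r) F i z).
Proof.
move=> cF; elim: r => [|i r IH].
  by under eq_fun do rewrite big_nil; exact: cst_continuous.
under eq_fun do rewrite big_cons.
by move=> z; apply: (@continuousD _ _ _ (F i)); [exact: cF | exact: IH].
Qed.

(** The topology comes from the sup norm, so the objective is rewritten as a polynomial in the
    coordinates, which are continuous. *)
Lemma prox_obj_continuous n (g : R) (w u : 'cV[R]_n) : continuous (prox_obj g w u).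
Proof.
have -> : prox_obj g w u =
    fun z => \sum_i ((z i 0 - w i 0) * (g * u i 0 + 2^-1 * (z i 0 - w i 0))).
  apply/funext => z; rewrite /prox_obj sqr_enorm !mulr_sumr -big_split /=.
  by apply: eq_bigr => i _; rewrite !mxE; ring.
apply: continuous_sum => i.
have ci : continuous (fun z : 'cV[R]_n => z i 0) by exact: coord_continuous.
have cB : continuous (fun z : 'cV[R]_n => z i 0 - w i 0).
  move=> z; apply: (@continuousB _ _ _ (fun z : 'cV[R]_n => z i 0) (fun => w i 0)).
    exact: ci.
  exact: cst_continuous.
have cS : continuous (fun z : 'cV[R]_n => g * u i 0 + 2^-1 * (z i 0 - w i 0)).
  move=> z; apply: (@continuousD _ _ _ (fun=> g * u i 0)
    (fun z : 'cV[R]_n => 2^-1 * (z i 0 - w i 0))).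
    exact: cst_continuous.
  apply: (@continuousM _ _ (fun=> 2^-1) (fun z : 'cV[R]_n => z i 0 - w i 0)).
    exact: cst_continuous.
  exact: cB.
by move=> z; apply: (@continuousM _ _ (fun z : 'cV[R]_n => z i 0 - w i 0)); [exact: cB | exact: cS].
Qed.

(* The prox objective is separable, so it is minimized player by player and the
   compactness of the product is not needed. *)
Lemma Xhat_proximinal x0 : Xhat P x0 -> proximinal (Xhat P).
Proof.
move=> Xx0 g w u.
(* [cid] turns existence into data, so that the minimizers of the players can be assembled into one
   vector. *)
have fP i : {z | Xhat_ P i z /\ forall b, Xhat_ P i b ->
    prox_obj g (submxcol w i) (submxcol u i) z <=
    prox_obj g (submxcol w i) (submxcol u i) b}.
  apply: cid; have [|||c cX cmin] := @compact_EVT_min _ _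
    (prox_obj g (submxcol w i) (submxcol u i)) (Xhat_ P i).
  - by exists (submxcol x0 i); exact: Xx0.
  - exact: Xhat_compact.
  - by apply: continuous_subspaceT; exact: prox_obj_continuous.
  by exists c; split=> [|y Xy]; [exact: set_mem | apply: cmin; exact: mem_set].
exists (\mxcol_i sval (fP i)); split.
  by apply: Xhat_mxcol => i; exact: (svalP (fP i)).1.
have blocks z : prox_obj g w u z =
    \sum_i prox_obj g (submxcol w i) (submxcol u i) (submxcol z i).
  rewrite /prox_obj sqr_enorm !dot_mxcol !mulr_sumr -big_split /=.
  by apply: eq_bigr => i _; rewrite sqr_enorm submxcolB.
move=> y Xy; rewrite !blocks; apply: ler_sum => i _.
by rewrite mxcolK; exact: (svalP (fP i)).2.
Qed.

End Players.

(** * Convexity and smoothness of the quadratic penalty *)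

Section Penalty.
Variables (R : realType) (N S : nat) (P : ngnep R N S).
Local Notation vec := 'cV[R]_(\sum_(i < N) dimx P i).
Implicit Types (x y h : vec) (s : 'I_S).

Lemma v_lipschitz lth x y : 0 < lth -> player_lipschitz P lth ->
  Xhat P x -> Xhat P y ->
  dot (v P x - v P y) (v P x - v P y) <=
  (Num.sqrt N%:R * lth) ^+ 2 * dot (x - y) (x - y).
Proof.
move=> lth0 lip Xx Xy; rewrite exprMn sqr_sqrtr ?ler0n // dot_mxcol.
apply: (@le_trans _ _ (\sum_(i < N) lth ^+ 2 * dot (x - y) (x - y))); last first.
  by rewrite sumr_const card_ord mulr_natl mulrnAl.
apply: ler_sum => i _; rewrite submxcolB !mxcolK -!sqr_enorm -exprMn.
by rewrite ler_sqr ?nnegrE ?mulr_ge0 ?enorm_ge0 ?(ltW lth0) //; exact: lip.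
Qed.

Lemma ineq_resD h x s : ineq_res (h + x) s = ineq_res x s + Amx P s *m xN h s.
Proof.
by rewrite /ineq_res -{1}[h]scale1r xN_linear scale1r mulmxDr -addrA addrC.
Qed.

Lemma eq_resD h x s : eq_res (h + x) s = eq_res x s + Emx P s *m xN h s.
Proof.
by rewrite /eq_res -{1}[h]scale1r xN_linear scale1r mulmxDr -addrA addrC.
Qed.

(** The square of [max 0 a] is convex with a 2-Lipschitz derivative; coordinatewise this is a case
    analysis on signs. *)
Lemma pospart_quadratic n (u d : 'cV[R]_n) :
  0 <= dot (pospart (u + d)) (pospart (u + d)) - dot (pospart u) (pospart u)
       - 2 * dot (pospart u) d <= dot d d.
Proof.
have scalar (a b : R) : 0 <= Num.max 0 (a + b) * Num.max 0 (a + b)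
    - Num.max 0 a * Num.max 0 a - 2 * (Num.max 0 a * b) <= b * b.
  by rewrite !maxEle; case: (leP 0 (a + b)) => ?; case: (leP 0 a) => ?;
    apply/andP; split; nra.
rewrite mulr_sumr -!sumrB.
apply/andP; split; [apply: sumr_ge0 => i _ | apply: ler_sum => i _];
  by have /andP[] := scalar (u i 0) (d i 0); rewrite !mxE.
Qed.

Definition penalty_differential (beta rho : 'I_S -> R) x h : R :=
  \sum_s beta s * dot (pospart (ineq_res x s)) (Amx P s *m xN h s)
  + \sum_s rho s * dot (eq_res x s) (Emx P s *m xN h s).

Variables beta rho : 'I_S -> R.
Hypotheses (beta0 : forall s, 0 < beta s) (rho0 : forall s, 0 < rho s).
Local Notation lG := (penalty_smoothness P beta rho).
Local Notation pen := (@penalty R N S P beta rho).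
Local Notation dpen := (@penalty_differential beta rho).

(** The lower bound is convexity and the upper one smoothness; together they also identify the
    gradient. Equality constraints have an exact quadratic remainder, inequality constraints one
    between zero and that. *)
Lemma penalty_expansion x h :
  0 <= pen (h + x) - pen x - dpen x h <= lG / 2 * dot h h.
Proof.
have -> : pen (h + x) - pen x - dpen x h =
  \sum_s (beta s / 2 * (dot (pospart (ineq_res (h + x) s)) (pospart (ineq_res (h + x) s))
            - dot (pospart (ineq_res x s)) (pospart (ineq_res x s))
            - 2 * dot (pospart (ineq_res x s)) (Amx P s *m xN h s))
          + rho s / 2 * dot (Emx P s *m xN h s) (Emx P s *m xN h s)).
  rewrite /penalty /penalty_differential big_split /=.
  rewrite !opprD [X in X + _]addrACA [LHS]addrACA -!sumrB.
  congr (_ + _); apply: eq_bigr => s _; rewrite !sqr_enorm; first by field.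
  by rewrite eq_resD; move: (eq_res x s) (_ *m _) => r q; rewrite !dotE (dotC q); field.
rewrite /penalty_smoothness mulrAC -mulrA mulr_suml.
apply/andP; split; [apply: sumr_ge0 => s _ | apply: ler_sum => s _].
  have := pospart_quadratic (ineq_res x s) (Amx P s *m xN h s).
  rewrite -ineq_resD => /andP[q0 _].
  by rewrite addr_ge0 ?mulr_ge0 ?dotxx_ge0 ?invr_ge0 ?(ltW (beta0 s)) ?(ltW (rho0 s)).
have := pospart_quadratic (ineq_res x s) (Amx P s *m xN h s).
rewrite -ineq_resD => /andP[_ q1].
have bound m n (A : 'M[R]_(m, n)) z : dot z z <= dot h h ->
    dot (A *m z) (A *m z) <= specnorm A ^+ 2 * dot h h.
  by move=> zh; rewrite (le_trans (dot_mulmx_le A z)) // ler_wpM2l ?sqr_ge0.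
have qA := le_trans q1 (bound _ _ (Amx P s) _ (dot_xN_le h s)).
have qE := bound _ _ (Emx P s) _ (dot_xN_le h s).
have b2 : 0 <= beta s / 2 by rewrite divr_ge0 // ltW.
have r2 : 0 <= rho s / 2 by rewrite divr_ge0 // ltW.
have {}qA := ler_wpM2l b2 qA; have {}qE := ler_wpM2l r2 qE.
by apply: le_trans (lerD qA qE) _; rewrite le_eqVlt; apply/orP; left; apply/eqP; field.
Qed.

Lemma penalty_differential_linear x a y z :
  dpen x (a *: y + z) = a * dpen x y + dpen x z.
Proof.
rewrite /penalty_differential mulrDr !mulr_sumr -!big_split /=.
by apply: eq_bigr => s _; rewrite xN_linear !mulmxDr -!scalemxAr !dotDr !dotZr; ring.
Qed.

Lemma dot_grad_penalty x h : dot (grad pen x) h = dpen x h.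
Proof.
apply: (@dot_grad _ _ _ _ _ (lG / 2)); first exact: penalty_differential_linear.
by move=> {}h; have /andP[h0 h1] := penalty_expansion x h; rewrite ger0_norm.
Qed.

Lemma penalty_smooth_convex : smooth_convex pen lG.
Proof.
move=> x y; have /andP[] := penalty_expansion x (y - x).
by rewrite subrK dot_grad_penalty => h0 h1; split; lra.
Qed.

Lemma penalty_ge0 x : 0 <= pen x.
Proof.
by rewrite addr_ge0 // sumr_ge0 // => s _; rewrite mulr_ge0 ?sqr_ge0 // divr_ge0 // ltW.
Qed.

Lemma penalty_smoothness_ge0 : 0 <= lG.
Proof.
by apply: sumr_ge0 => s _; rewrite addr_ge0 // mulr_ge0 ?sqr_ge0 // ltW.
Qed.

Lemma penalty_feasible x : (forall s, pospart (ineq_res x s) = 0) ->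
  (forall s, eq_res x s = 0) -> pen x = 0.
Proof.
move=> xA xE; rewrite /penalty !big1 ?addr0 // => s _.
  by rewrite xE enorm0 expr0n mulr0.
by rewrite xA enorm0 expr0n mulr0.
Qed.

(** The penalty and its gradient both vanish at a feasible [x], so only the smoothness term
    survives. *)
Lemma penalty_le_dist x y : (forall s, pospart (ineq_res x s) = 0) ->
  (forall s, eq_res x s = 0) -> pen y <= lG / 2 * dot (y - x) (y - x).
Proof.
move=> xA xE; have [_] := penalty_smooth_convex x y.
rewrite (penalty_feasible xA xE) dot_grad_penalty /penalty_differential !big1 ?addr0 ?add0r //.
  by move=> s _; rewrite xE dot0l mulr0.
by move=> s _; rewrite xA dot0l mulr0.
Qed.

End Penalty.

(** * Iteration counts for one run of AMP *)

Section AMPComplexity.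
Variables (R : realType) (n : nat).
Local Notation vec := 'cV[R]_n.
Variables (Z : set vec) (F : vec -> vec) (G : vec -> R) (alpha lF lG D : R).
Hypotheses (cZ : convex_subset Z) (pZ : proximinal Z).
Hypothesis lipF : forall x y, Z x -> Z y ->
  dot (F x - F y) (F x - F y) <= lF ^+ 2 * dot (x - y) (x - y).
Hypothesis monF : forall x y, Z x -> Z y ->
  alpha * dot (x - y) (x - y) <= dot (x - y) (F x - F y).
Hypothesis scG : smooth_convex G lG.
Hypothesis lG_ge0 : 0 <= lG.
Hypothesis diamZ : forall x y, Z x -> Z y -> dot (x - y) (x - y) <= D ^+ 2.

Local Notation stops_at := (amp_stops_at Z F G alpha lF lG).
Local Notation point := (amp_point Z F G alpha lF lG).

(** AMP returns at the first success, so it suffices to exhibit any iteration that passes the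
    test. *)
Lemma amp_first_stop x0 e i : amp_criterion Z F G e (point x0 i) ->
  exists j, stops_at x0 e j /\ (j <= i)%N.
Proof.
move=> crit_i; pose p j := `[< amp_criterion Z F G e (point x0 j) >].
have ex : exists j, p j by exists i; exact/asboolP.
case: (ex_minnP ex) => j /asboolP crit_j minj; exists j; split; last first.
  by apply: minj; exact/asboolP.
by split => // l lj crit_l; have := minj l (introT (asboolP _) crit_l); rewrite leqNgt lj.
Qed.

(** Here [t] is the current power of [gamma]. With [lG <= L * t] and accuracy [d / t], both error
    terms, of order [t / i ^+ 2] and [1 / i], are small enough once [i] is a constant times [t]. *)
Lemma amp_monotone_stop L d t x0 : alpha = 0 -> 0 < lF -> Z x0 ->
  0 <= L -> lG <= L * t -> 0 < d -> 1 <= t ->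
  exists i, [/\ stops_at x0 (d / t) i, Z (point x0 i) &
    i%:R <= (2 + (8 * L + 6 * lF) * D ^+ 2 / d) * t].
Proof.
move=> alpha0 lF0 Zx0 L0 lGt d0 t1.
have t0 : 0 < t by lra.
pose q := (8 * L + 6 * lF) * D ^+ 2 / d.
have q0 : 0 <= q by rewrite divr_ge0 ?(ltW d0) // mulr_ge0 ?sqr_ge0 // addr_ge0 // mulr_ge0 // ltW.
have qd : q * d = (8 * L + 6 * lF) * D ^+ 2 by rewrite divfK // gt_eqF.
(* The share [q * t] absorbs the error constants; the share [t] gives [t <= i] and keeps [i]
   positive. *)
rewrite -/q; pose i := (Num.truncn ((1 + q) * t)).+1.
have ile : i%:R <= (2 + q) * t.
  have h : (Num.truncn ((1 + q) * t))%:R <= (1 + q) * t.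
    by rewrite truncn_le mulr_ge0 ?(ltW t0) // addr_ge0.
  by rewrite /i -natr1; lra.
have igt : (1 + q) * t < i%:R by exact: truncnS_gt.
have [|j [stop_j ji]] := @amp_first_stop x0 (d / t) i.
  apply: amp_criterion_gap => z Zz.
  have := amp_monotone_gap cZ pZ lipF monF scG lG_ge0 diamZ i alpha0 lF0 Zx0 Zz.
  set Q := gap _ _ _ _; set w := (amp_iter _ _ _ _ _ _ _ _).2; rewrite -natr1.
  move: i%:R ile igt => I ile igt.
  have I0 : 0 < I by apply: le_lt_trans igt; rewrite mulr_ge0 ?(ltW t0) // addr_ge0.
  have w0 : 0 <= (4 * lG + 3 * I * lF) * dot (z - w) (z - w).
    apply: mulr_ge0 (dotxx_ge0 _); apply: addr_ge0; first by rewrite mulr_ge0.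
    by rewrite !mulr_ge0 // ltW.
  have D0 := sqr_ge0 D.
  move=> bnd; rewrite ler_pdivlMr // -(ler_pM2l (mulr_gt0 I0 (addr_gt0 I0 ltr01))).
  have QI : I * (I + 1) * (Q * t) <= (4 * (L * t) + 3 * I * lF) * D ^+ 2 * t.
    rewrite [leLHS]mulrA; apply: ler_wpM2r (ltW t0) _ _ _.
    apply: (@le_trans _ _ ((4 * lG + 3 * I * lF) * D ^+ 2)); first by lra.
    by apply: ler_wpM2r => //; move: lGt; lra.
  have qtI : q * t <= I by lra.
  have LD : 0 <= L * D ^+ 2 by rewrite mulr_ge0.
  have lD : 0 <= lF * D ^+ 2 by rewrite mulr_ge0 // ltW.
  have Id : (8 * L + 6 * lF) * D ^+ 2 * t <= I * d.
    by rewrite -qd mulrAC ler_wpM2r // ltW.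
  have tI : t <= I by apply: le_trans (ltW igt); rewrite ler_peMl ?(ltW t0) // lerDl.
  have h1 : 8 * (L * D ^+ 2) * t * t <= I * d * t.
    by rewrite ler_wpM2r ?(ltW t0) //; apply: le_trans Id; rewrite ler_wpM2r ?(ltW t0) //; lra.
  have h2 : I * d * t <= I * d * I by rewrite ler_wpM2l // mulr_ge0 ?ltW.
  have h3 : 6 * (lF * D ^+ 2) * t * I <= I * d * I.
    by rewrite ler_wpM2r ?(ltW I0) //; apply: le_trans Id; rewrite ler_wpM2r ?(ltW t0) //; lra.
  have Id0 : 0 <= I * d by rewrite mulr_ge0 ?ltW.
  apply: le_trans QI _; lra.
exists j; split => //.
  have a01 k : 0 <= amp_alpha alpha lF lG k.+1 /\ amp_alpha alpha lF lG k.+1 <= 1.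
    rewrite /amp_alpha alpha0 eqxx; split; first by rewrite divr_ge0.
    by rewrite ler_pdivrMr ?ltr0n // mul1r ler_nat.
  by have [] := @amp_iter_in _ _ Z F G _ _ _ cZ pZ x0 Zx0 a01 j.
by apply: le_trans ile; rewrite ler_nat.
Qed.

(** Here [r] stands for the square root of [gamma]: the inverse step size grows like the root of
    [lG], that is like [r ^+ k], and the logarithm of the required reduction grows linearly in
    [k]. *)
Lemma amp_strong_stop L d M r k x0 : 0 < alpha -> alpha <= lF -> Z x0 ->
  0 <= L -> lG <= L * (r ^+ 2) ^+ k -> 0 < d -> d <= 1 -> 1 <= M -> 1 < r ->
  (forall z, Z z -> gap F G z x0 + alpha / 2 * dot (z - x0) (z - x0) <= M * (r ^+ 2) ^+ k) ->
  exists i, [/\ stops_at x0 (d / (r ^+ 2) ^+ k) i, Z (point x0 i) &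
    i%:R <= (1 + 4 * (lF / alpha + Num.sqrt (L / alpha)) * (ln (M / d) + 4 * ln r))
            * (k.+1%:R * r ^+ k)].
Proof.
move=> al0 allF Zx0 L0 lGt d0 d1 M1 r1 init; set t := (r ^+ 2) ^+ k in lGt init *.
have r0 : 0 < r by lra.
have t0 : 0 < t by rewrite !exprn_gt0.
have M0 : 0 < M by lra.
have a_const j : amp_alpha alpha lF lG j = amp_alpha alpha lF lG 1.
  by rewrite /amp_alpha gt_eqF.
have [a0 alF _ ainv] := amp_alpha_strong lG_ge0 1 al0 allF.
have a1 : amp_alpha alpha lF lG 1 <= 1.
  rewrite -(ler_pM2r (lt_le_trans al0 allF)) (le_trans alF) //; lra.
set a := amp_alpha alpha lF lG 1 in a0 a1 ainv a_const.
(* [expR X] is the factor [M / d * t ^+ 2] by which the initial value [M * t] must shrink to reach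
   [d / t]. *)
pose X := ln (M / d) + k%:R * (4 * ln r).
have lnMd : 0 <= ln (M / d) by rewrite ln_ge0 // ler_pdivlMr // mul1r; lra.
have lnr : 0 <= ln r by rewrite ln_ge0 // ltW.
have X0 : 0 <= X by rewrite addr_ge0 // mulr_ge0 // mulr_ge0.
have expX : expR X = M / d * t ^+ 2.
  rewrite expRD lnK ?posrE ?divr_gt0 // expRM_natl; congr (_ * _).
  by rewrite expRM_natl lnK ?posrE // /t -!exprM; congr (r ^+ _); rewrite [RHS]mulnCA [RHS]mulnC.
pose i := (Num.truncn (a^-1 * X)).+1.
have aX0 : 0 <= a^-1 * X by rewrite mulr_ge0 // invr_ge0 ltW.
have ile : i%:R <= a^-1 * X + 1 by rewrite /i -natr1 lerD2r truncn_le.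
have igt : X <= a * i%:R.
  by rewrite -ler_pdivrMl //; apply/ltW/truncnS_gt.
have [|j [stop_j ji]] := @amp_first_stop x0 (d / t) i.
  apply: amp_criterion_gap => z Zz.
  have := amp_strong_gap cZ pZ lipF monF scG lG_ge0 i al0 allF Zx0 Zz.
  have := init z Zz; set M' := gap _ _ _ _ + _ => M'le.
  rewrite -/a; set Q := gap _ _ _ _; set w := (amp_iter _ _ _ _ _ _ _ _).2 => bnd.
  have w0 : 0 <= alpha / 2 * dot (z - w) (z - w).
    by rewrite mulr_ge0 ?dotxx_ge0 // divr_ge0 // ltW.
  apply: (@le_trans _ _ ((1 - a) ^+ i * M')).
    by apply: le_trans bnd; rewrite lerDl.
  apply: (@le_trans _ _ ((1 - a) ^+ i * (M * t))).
    by rewrite ler_wpM2l // exprn_ge0 // subr_ge0.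
  have decay : (1 - a) ^+ i <= (expR X)^-1.
    apply: (@le_trans _ _ (expR (- a) ^+ i)).
      by rewrite lerXn2r ?nnegrE ?subr_ge0 ?expR_ge0 // expR_ge1Dx.
    by rewrite -expRM_natl -expRN ler_expR mulrN lerN2 mulrC.
  apply: (@le_trans _ _ ((expR X)^-1 * (M * t))).
    by rewrite ler_wpM2r // mulr_ge0 // ltW.
  rewrite expX le_eqVlt; apply/orP; left; apply/eqP; field.
  by rewrite !gt_eqF.
exists j; split => //.
  have a01 l : 0 <= amp_alpha alpha lF lG l.+1 /\ amp_alpha alpha lF lG l.+1 <= 1.
    by rewrite a_const -/a; split => //; exact: ltW.
  by have [] := @amp_iter_in _ _ Z F G _ _ _ cZ pZ x0 Zx0 a01 j.
have rk1 : 1 <= r ^+ k by rewrite exprn_ege1 // ltW.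
have k1 : 1 <= k.+1%:R :> R by rewrite ler1n.
apply: (@le_trans _ _ (a^-1 * X + 1)); first by apply: le_trans ile; rewrite ler_nat.
have sqL : Num.sqrt (lG / alpha) <= Num.sqrt (L / alpha) * r ^+ k.
  have -> : Num.sqrt (L / alpha) * r ^+ k = Num.sqrt (L * t / alpha).
    have -> : L * t / alpha = L / alpha * (r ^+ k) ^+ 2 by rewrite /t -exprM mulnC exprM mulrAC.
    by rewrite [RHS]sqrtrM ?divr_ge0 ?(ltW al0) // sqrtr_sqr ger0_norm // exprn_ge0 // ltW.
  by rewrite ler_wsqrtr // ler_wpM2r // invr_ge0 ltW.
have lFa : 0 <= lF / alpha by rewrite divr_ge0 // ltW // (lt_le_trans al0).
have ainv' : a^-1 <= 4 * (lF / alpha + Num.sqrt (L / alpha)) * r ^+ k.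
  apply: le_trans ainv _; rewrite -mulrA ler_wpM2l // mulrDl lerD //.
  by rewrite ler_peMr.
have XK : X <= k.+1%:R * (ln (M / d) + 4 * ln r).
  rewrite /X mulrDr lerD //; first by rewrite ler_peMl.
  by apply: ler_wpM2r; [exact: mulr_ge0 | rewrite ler_nat].
have := ler_pM _ X0 ainv' XK; rewrite invr_ge0 (ltW a0) => /(_ isT) aXle.
rewrite [leRHS]mulrDl mul1r addrC lerD //; first by rewrite mulr_ege1.
apply: le_trans aXle _; rewrite le_eqVlt; apply/orP; left; apply/eqP; ring.
Qed.

End AMPComplexity.

(** * From the stopping criterion to eps-solutions *)

Section Outer.
Variables (R : realType) (N S : nat) (P : ngnep R N S).
Local Notation vec := 'cV[R]_(\sum_(i < N) dimx P i).
Implicit Types (x y h : vec) (s : 'I_S).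

(** Covers the degenerate cases [lF <= 0] and [lF < alpha], where [Xhat P] has at most one point. *)
Lemma amp_trivial_stop alpha lF lG G e x : 0 <= e -> Xhat P x ->
  (forall y y', Xhat P y -> Xhat P y' -> y = y') ->
  amp_stops_at (Xhat P) (v P) G alpha lF lG x e 0.
Proof.
move=> e0 Xx uniqX; split=> // y Xy.
by rewrite /amp_point /= (uniqX _ _ Xx Xy) !subrr dot0l addr0.
Qed.

(* Strong monotonicity with modulus above the Lipschitz constant forces a
   one-point set; there the AMP parameters need not satisfy [a <= 1]. *)
Lemma Xhat_unique alpha lF : lF < alpha -> 0 <= lF -> ngnep_monotone P alpha ->
  (forall x y, Xhat P x -> Xhat P y ->
    dot (v P x - v P y) (v P x - v P y) <= lF ^+ 2 * dot (x - y) (x - y)) ->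
  forall x y, Xhat P x -> Xhat P y -> x = y.
Proof.
move=> lFa lF0 mon lip x y Xx Xy; apply/subr0_eq/dotxx_eq0/eqP.
rewrite eq_le dotxx_ge0 andbT -sqr_enorm.
have := mon _ _ Xx Xy; have := lip _ _ Xx Xy.
rewrite -!sqr_enorm -exprMn ler_sqr ?nnegrE ?mulr_ge0 ?enorm_ge0 // => lv.
have := le_trans (cauchy_schwarz (x - y) (v P x - v P y)) (ler_wpM2l (enorm_ge0 _) lv).
move=> h1 /le_trans/(_ h1) h2.
by rewrite -(pmulr_rle0 _ (_ : 0 < alpha - lF)) ?subr_gt0 //; lra.
Qed.

(* [b] is a potential: its increments pay for the three evaluations of each
   iteration. *)
Lemma ampqp_run_exists alpha lth gamma delta0 (beta0 rho0 : 'I_S -> R) x0 (b : nat -> R) :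
  Xhat P x0 -> 0 <= b 0%N ->
  (forall k x, Xhat P x ->
    let G := @penalty R N S P (beta_ gamma beta0 k.+1) (rho_ gamma rho0 k.+1) in
    let lF := Num.sqrt N%:R * lth in
    let lG := penalty_smoothness P (beta_ gamma beta0 k.+1) (rho_ gamma rho0 k.+1) in
    exists i, [/\ amp_stops_at (Xhat P) (v P) G alpha lF lG x (delta_ gamma delta0 k.+1) i,
      Xhat P (amp_point (Xhat P) (v P) G alpha lF lG x i) &
      3 * i%:R <= b k.+1 - b k]) ->
  forall T, exists x c, [/\ ampqp_run P alpha lth gamma delta0 beta0 rho0 x0 T x c, Xhat P x,
    (0 < T)%N -> amp_criterion (Xhat P) (v P)
      (@penalty R N S P (beta_ gamma beta0 T) (rho_ gamma rho0 T)) (delta_ gamma delta0 T) x &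
    c%:R <= b T].
Proof.
move=> Xx0 b0 step; elim=> [|T [x [c [run Xx _ cb]]]].
  by exists x0, 0%N; split => //; exact: ampqp_init.
have /= [i [stop_i Xi ib]] := step T x Xx.
exists (amp_point (Xhat P) (v P) (@penalty R N S P (beta_ gamma beta0 T.+1) (rho_ gamma rho0 T.+1))
  alpha (Num.sqrt N%:R * lth)
  (penalty_smoothness P (beta_ gamma beta0 T.+1) (rho_ gamma rho0 T.+1)) x i).
exists (c + amp_evals i)%N; split => //.
- exact: ampqp_next.
- by move=> _; exact: stop_i.1.
- by rewrite natrD /amp_evals natrM; lra.
Qed.

Lemma submxcol_deviate x (nu : 'I_N) (u : 'cV[R]_(dimx P nu)) i :
  submxcol (deviate x u) i = dfwith (fun i => submxcol x i) nu u i.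
Proof. by rewrite mxcolK. Qed.

Lemma Xhat_deviate x (nu : 'I_N) (u : 'cV[R]_(dimx P nu)) :
  Xhat P x -> Xhat_ P nu u -> Xhat P (deviate x u).
Proof.
move=> Xx Xu i; rewrite submxcol_deviate.
by case: dfwithP => // j _; exact: Xx.
Qed.

Lemma xN_deviate x (nu : 'I_N) (u : 'cV[R]_(dimx P nu)) s :
  nu \notin Nset P s -> xN (deviate x u) s = xN x s.
Proof.
move=> nus; apply/mxcolP => j; rewrite /xN [LHS]mxcolK [RHS]mxcolK submxcol_deviate dfwithout //.
by apply: contraNneq nus => ->; exact: enum_valP.
Qed.

(** Only the block of [nu] changes, so the criterion tested at a unilateral deviation is that
    player's own optimality inequality. *)
Lemma dot_deviate x (nu : 'I_N) (u : 'cV[R]_(dimx P nu)) :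
  dot (x - deviate x u) (v P (deviate x u)) =
  dot (submxcol x nu - u) (v_ nu (deviate x u)).
Proof.
rewrite dot_mxcol (bigD1 nu) //= [X in _ + X]big1 => [|i inu].
  by rewrite submxcolB submxcol_deviate dfwithin mxcolK addr0.
by rewrite submxcolB submxcol_deviate dfwithout 1?eq_sym // subrr dot0l.
Qed.

Lemma dot_le_pospart n (lam u : 'cV[R]_n) : (forall i, 0 <= lam i 0) ->
  dot lam u <= dot lam (pospart u).
Proof.
by move=> lam0; apply: ler_sum => i _; rewrite ler_wpM2l // !mxE le_max lexx orbT.
Qed.

Lemma pospart_le0 n (u : 'cV[R]_n) : (forall i, u i 0 <= 0) -> pospart u = 0.
Proof. by move=> u0; apply/colP => i; rewrite !mxE max_l. Qed.

(** The criterion is tested at the KKT point, where the penalty vanishes. The KKT inequality trades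
    the remaining term in [v] for multiplier terms, which complementarity and affinity of the
    constraints turn into residuals at [x]. *)
Lemma penalty_le_multipliers (beta rho : 'I_S -> R) Lam e x :
  KKT_bounded P Lam -> Xhat P x ->
  amp_criterion (Xhat P) (v P) (@penalty R N S P beta rho) e x ->
  penalty beta rho x <= e + \sum_s (Lam * enorm (pospart (ineq_res x s))
                                    + Lam * enorm (eq_res x s)).
Proof.
move=> [xs [lam [mu [[Xs feasA feasE compl vi] bnd]]]] Xx crit.
have := crit xs Xs; rewrite [penalty _ _ xs]penalty_feasible ?subr0 //; last first.
  by move=> s; apply: pospart_le0 => i; have [] := feasA s i.
have := vi x Xx.
suff : \sum_s (dot (lam s) (Amx P s *m xN (x - xs) s) + dot (mu s) (Emx P s *m xN (x - xs) s))
    <= \sum_s (Lam * enorm (pospart (ineq_res x s)) + Lam * enorm (eq_res x s)).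
  by lra.
apply: ler_sum => s _; apply: lerD.
  have -> : Amx P s *m xN (x - xs) s = ineq_res x s - ineq_res xs s.
    by rewrite -{2}(subrK xs x) ineq_resD addrAC subrr add0r.
  rewrite dotBr compl subr0 (le_trans (dot_le_pospart _ (fun i => (feasA s i).2))) //.
  rewrite (le_trans (cauchy_schwarz _ _)) // ler_wpM2r ?enorm_ge0 //.
  by have [] := bnd s.
have -> : Emx P s *m xN (x - xs) s = eq_res x s.
  by rewrite -{2}(subrK xs x) eq_resD feasE add0r.
rewrite (le_trans (cauchy_schwarz _ _)) // ler_wpM2r ?enorm_ge0 //.
by have [] := bnd s.
Qed.

(* Completing the square: [b t p^2 / 2 - Lam p >= b t p^2 / 4 - Lam^2 / (b t)]
   for each residual [p]. *)
Lemma residual_le (beta rho : 'I_S -> R) Lam b t d x : 0 < b -> 0 < t -> 0 <= d ->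
  (forall s, b * t <= beta s) -> (forall s, b * t <= rho s) ->
  KKT_bounded P Lam -> Xhat P x ->
  amp_criterion (Xhat P) (v P) (@penalty R N S P beta rho) (d / t) x ->
  forall s, enorm (pospart (ineq_res x s)) <= (1 + 4 / b * (d + 2 * S%:R * Lam ^+ 2 / b)) / t /\
            enorm (eq_res x s) <= (1 + 4 / b * (d + 2 * S%:R * Lam ^+ 2 / b)) / t.
Proof.
move=> b0 t0 d0 bb br kkt Xx crit s.
have := penalty_le_multipliers kkt Xx crit.
rewrite /penalty -big_split /= -lerBlDr -sumrB => sum_le.
have bt0 : 0 < b * t by rewrite mulr_gt0.
pose m := Lam ^+ 2 / (b * t).
have square p c : b * t <= c -> b * t / 4 * p ^+ 2 - m <= c / 2 * p ^+ 2 - Lam * p.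
  move=> cb; have : b * t * p ^+ 2 <= c * p ^+ 2 by rewrite ler_wpM2r ?sqr_ge0.
  have : 0 <= (b * t) * (p / 2 - Lam / (b * t)) ^+ 2 by rewrite mulr_ge0 ?sqr_ge0 // ltW.
  have -> : b * t * (p / 2 - Lam / (b * t)) ^+ 2 = b * t / 4 * p ^+ 2 - Lam * p + m.
    by rewrite /m; field; rewrite !gt_eqF.
  lra.
pose sq i := enorm (pospart (ineq_res x i)) ^+ 2 + enorm (eq_res x i) ^+ 2.
have sum_sq : \sum_i (b * t / 4 * sq i - 2 * m) <= d / t.
  apply: le_trans sum_le; apply: ler_sum => i _; rewrite /sq.
  have := square (enorm (pospart (ineq_res x i))) _ (bb i).
  have := square (enorm (eq_res x i)) _ (br i).
  by lra.
rewrite sumrB sumr_const card_ord -mulr_sumr in sum_sq.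
have sq_s : sq s <= \sum_i sq i.
  by rewrite (bigD1 s) //= lerDl sumr_ge0 // => i _; rewrite addr_ge0 ?sqr_ge0.
pose q := 4 / b * (d + 2 * S%:R * Lam ^+ 2 / b).
have q0 : 0 <= q.
  apply: mulr_ge0; first by rewrite divr_ge0 // ltW.
  by apply: addr_ge0 => //; rewrite divr_ge0 ?(ltW b0) // mulr_ge0 ?sqr_ge0 // mulr_ge0.
(* [q <= (1 + q) ^+ 2] spares a square root in the constant. *)
have sq_le : sq s <= ((1 + q) / t) ^+ 2.
  have : b * t / 4 * sq s <= d / t + 2 * m *+ S.
    rewrite -lerBlDr; apply: le_trans sum_sq; rewrite lerD2r ler_wpM2l //.
    by rewrite divr_ge0 // ltW.
  rewrite -ler_pdivlMl; last by rewrite divr_gt0.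
  move=> /le_trans; apply.
  have -> : (b * t / 4)^-1 * (d / t + 2 * m *+ S) = q / t ^+ 2.
    by rewrite -mulr_natr /q /m; field; rewrite !gt_eqF.
  rewrite expr_div_n ler_wpM2r ?invr_ge0 ?sqr_ge0 //; nra.
have root p : 0 <= p -> p ^+ 2 <= sq s -> p <= (1 + q) / t.
  move=> p0 /le_trans/(_ sq_le); rewrite ler_sqr // nnegrE //.
  by rewrite divr_ge0 ?addr_ge0 // ltW.
by split; apply: root; rewrite ?enorm_ge0 // /sq ?lerDl ?lerDr sqr_ge0.
Qed.

(** [1 <= t * eps] makes the accuracy [d / t] at most [eps]; [t * eps <= c] makes the penalty of an
    eps-feasible deviation, of order [t * eps ^+ 2], at most a multiple of [eps]. No logarithm
    appears, hence the exponent 0. *)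
Lemma eps_solution_of_criterion (beta rho : 'I_S -> R) B c t d eps x :
  0 < t -> 0 <= d -> d <= 1 -> 0 <= B -> 0 <= c -> 0 < eps -> 1 <= t * eps -> t * eps <= c ->
  (forall s, 0 < beta s) -> (forall s, 0 < rho s) ->
  (forall s, beta s <= B * t) -> (forall s, rho s <= B * t) ->
  Xhat P x ->
  (forall s, enorm (pospart (ineq_res x s)) <= eps /\ enorm (eq_res x s) <= eps) ->
  amp_criterion (Xhat P) (v P) (@penalty R N S P beta rho) (d / t) x ->
  eps_solution P (1 + S%:R * B * c) 0 eps x.
Proof.
move=> t0 d0 d1 B0 c0 eps0 te1 tec beta0 rho0 bB rB Xx feas crit.
split => // nu u Xu ufeas; rewrite expr0 mulr1 -dot_deviate.
set y := deviate x u.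
(* The deviation is only assumed eps-feasible for the constraints of [nu]; the others do not see it
   and inherit the bounds of [x]. *)
have yfeas s : enorm (pospart (ineq_res y s)) <= eps /\ enorm (eq_res y s) <= eps.
  have [/ufeas //|nus] := boolP (nu \in Nset P s).
  by rewrite /ineq_res /eq_res xN_deviate //; exact: feas.
have := crit y (Xhat_deviate Xx Xu); have := penalty_ge0 beta0 rho0 x.
have dt : d / t <= eps by rewrite ler_pdivrMr // mulrC; exact: le_trans te1.
suff : penalty beta rho y <= S%:R * B * c * eps by lra.
have sq_eps p : 0 <= p -> p <= eps -> p ^+ 2 <= eps ^+ 2.
  by move=> p0 pe; rewrite ler_sqr // nnegrE // ltW.
apply: (@le_trans _ _ (\sum_(s < S) B * t * eps ^+ 2)).
  rewrite /penalty -big_split /=; apply: ler_sum => s _; have [pA pE] := yfeas s.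
  have hA : beta s / 2 * enorm (pospart (ineq_res y s)) ^+ 2 <= B * t / 2 * eps ^+ 2.
    by rewrite ler_pM ?divr_ge0 ?sqr_ge0 ?ler_pM2r ?sq_eps ?enorm_ge0 ?(ltW (beta0 s)) ?invr_gt0.
  have hE : rho s / 2 * enorm (eq_res y s) ^+ 2 <= B * t / 2 * eps ^+ 2.
    by rewrite ler_pM ?divr_ge0 ?sqr_ge0 ?ler_pM2r ?sq_eps ?enorm_ge0 ?(ltW (rho0 s)) ?invr_gt0.
  lra.
rewrite sumr_const card_ord -[leLHS]mulr_natl.
have -> : S%:R * (B * t * eps ^+ 2) = S%:R * B * (t * eps) * eps by ring.
by rewrite ler_wpM2r ?(ltW eps0) // ler_wpM2l // mulr_ge0.
Qed.

End Outer.

(** * Choice of the number of runs and summation of their costs *)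

Section Assembly.
Variable R : realType.

Lemma bernoulli (g : R) n : 1 <= g -> 1 + n%:R * (g - 1) <= g ^+ n.
Proof.
move=> g1; elim: n => [|n IH]; first by rewrite mul0r addr0 expr0.
rewrite exprS -natr1; apply: le_trans (ler_wpM2l _ IH); last by lra.
by have := mulr_ge0 (ler0n R n) (sqr_ge0 (g - 1)); lra.
Qed.

(** The least exponent overshoots by at most one factor [g]. Positivity of [T] matters because the
    stopping criterion is known only after at least one run. *)
Lemma exists_expr_between (g X : R) : 1 < g -> 1 < X ->
  exists T, [/\ (0 < T)%N, X <= g ^+ T & g ^+ T <= g * X].
Proof.
move=> g1 X1; have ex : exists n, X <= g ^+ n.
  exists (Num.truncn (X / (g - 1))).+1; apply: le_trans (bernoulli _ (ltW g1)).
  have := truncnS_gt (X / (g - 1)); rewrite ltr_pdivrMr ?subr_gt0 // => h.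
  by lra.
case: (ex_minnP ex) => -[|T] XT minT; first by move: XT; rewrite expr0; lra.
exists T.+1; split => //; rewrite exprS ler_wpM2l //; first by lra.
by rewrite leNgt; apply/negP => /ltW/minT; rewrite ltnn.
Qed.

Variables (N S : nat) (P : ngnep R N S).
Variables (alpha lth D V K Lam gamma delta0 : R) (beta0 rho0 : 'I_S -> R).
Hypotheses (lth_gt0 : 0 < lth) (gamma_gt1 : 1 < gamma).
Hypotheses (delta0_gt0 : 0 < delta0) (delta0_lt1 : delta0 < 1).
Hypotheses (beta0_gt0 : forall s, 0 < beta0 s) (rho0_gt0 : forall s, 0 < rho0 s).
Hypotheses (lip : player_lipschitz P lth) (mon : ngnep_monotone P alpha).
Hypotheses (kkt : KKT_bounded P Lam) (data : data_bounded P D V K).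
Variable x0 : 'cV[R]_(\sum_(i < N) dimx P i).
Hypothesis Xx0 : Xhat P x0.

(** Sums replace the maximum and minimum of the parameters, so [S = 0] needs no special case. These
    constants do not mention [P], as the uniformity of the final bounds requires. *)
Definition param_max := \sum_s (beta0 s + rho0 s).
Definition param_min := (1 + \sum_s ((beta0 s)^-1 + (rho0 s)^-1))^-1.
Definition residual_factor :=
  1 + 4 / param_min * (delta0 + 2 * S%:R * Lam ^+ 2 / param_min).

Let lF := Num.sqrt N%:R * lth.
Let L := param_max * K ^+ 2.
Let beta k := beta_ gamma beta0 k.
Let rho k := rho_ gamma rho0 k.

Let gammaX_gt0 k : 0 < gamma ^+ k. Proof. by rewrite exprn_gt0 // (lt_trans ltr01). Qed.
Let gamma_ge0 : 0 <= gamma. Proof. exact: le_trans ler01 (ltW gamma_gt1). Qed.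
Let gammaX_ge1 k : 1 <= gamma ^+ k. Proof. by rewrite exprn_ege1 // ltW. Qed.
Let beta_gt0 k s : 0 < beta k s. Proof. by rewrite mulr_gt0. Qed.
Let rho_gt0 k s : 0 < rho k s. Proof. by rewrite mulr_gt0. Qed.

Lemma le_param_max s : beta0 s <= param_max /\ rho0 s <= param_max.
Proof.
have : beta0 s + rho0 s <= param_max.
  by rewrite /param_max (bigD1 s) //= lerDl sumr_ge0 // => i _; rewrite ltW // addr_gt0.
by move=> h; split; apply: le_trans h; rewrite ?lerDl ?lerDr ltW.
Qed.

Lemma param_max_ge0 : 0 <= param_max.
Proof. by rewrite sumr_ge0 // => s _; rewrite ltW // addr_gt0. Qed.

Lemma param_min_gt0 : 0 < param_min.
Proof.
by rewrite invr_gt0 ltr_pwDl // sumr_ge0 // => s _; rewrite addr_ge0 ?invr_ge0 ?ltW.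
Qed.

Lemma ge_param_min s : param_min <= beta0 s /\ param_min <= rho0 s.
Proof.
have inv0 : forall s, 0 <= (beta0 s)^-1 /\ 0 <= (rho0 s)^-1.
  by move=> i; rewrite !invr_ge0 !ltW.
have : (beta0 s)^-1 + (rho0 s)^-1 <= \sum_s ((beta0 s)^-1 + (rho0 s)^-1).
  by rewrite (bigD1 s) //= lerDl sumr_ge0 // => i _; have [] := inv0 i; exact: addr_ge0.
have [bs rs] := inv0 s => h.
by split; rewrite /param_min -[leRHS]invrK lef_pV2 ?posrE ?invr_gt0 //; lra.
Qed.

Lemma residual_factor_ge1 : 1 <= residual_factor.
Proof.
have b0 := ltW param_min_gt0.
rewrite lerDl mulr_ge0 ?divr_ge0 // addr_ge0 ?(ltW delta0_gt0) //.
by rewrite divr_ge0 // mulr_ge0 ?sqr_ge0 // mulr_ge0.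
Qed.

Lemma penalty_smoothness_le k : penalty_smoothness P (beta k) (rho k) <= L * gamma ^+ k.
Proof.
have [_ _ specK] := data.
rewrite /penalty_smoothness /L /param_max !mulr_suml; apply: ler_sum => s _.
have [sA sE] := specK s.
have sq (a : R) : 0 <= a -> a <= K -> a ^+ 2 <= K ^+ 2.
  by move=> a0 aK; rewrite ler_sqr // nnegrE // (le_trans a0).
have hA := ler_wpM2l (ltW (beta_gt0 k s)) (sq _ (specnorm_ge0 _) sA).
have hE := ler_wpM2l (ltW (rho_gt0 k s)) (sq _ (specnorm_ge0 _) sE).
by apply: le_trans (lerD hA hE) _; rewrite /beta /rho /beta_ /rho_; lra.
Qed.

Let L_ge0 : 0 <= L. Proof. by rewrite mulr_ge0 ?param_max_ge0 ?sqr_ge0. Qed.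

Let lF_ge0 : 0 <= lF. Proof. by rewrite mulr_ge0 ?sqrtr_ge0 ?ltW. Qed.

Let lipF x y : Xhat P x -> Xhat P y ->
  dot (v P x - v P y) (v P x - v P y) <= lF ^+ 2 * dot (x - y) (x - y).
Proof. exact: v_lipschitz. Qed.

Let monF x y : Xhat P x -> Xhat P y ->
  alpha * dot (x - y) (x - y) <= dot (x - y) (v P x - v P y).
Proof. by move=> Xx Xy; rewrite -sqr_enorm; exact: mon. Qed.

Let diam x y : Xhat P x -> Xhat P y -> dot (x - y) (x - y) <= D ^+ 2.
Proof.
move=> Xx Xy; have [diamD _ _] := data; have xyD := diamD _ _ Xx Xy.
by rewrite -ler_enorm // (le_trans (enorm_ge0 _) xyD).
Qed.

(** Shared by both cases. [T] is chosen with [gamma ^+ T] between [residual_factor / eps] and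
    [gamma] times that: the lower bound makes the residuals at most [eps], the upper one controls
    deviations and cost. *)
Lemma ampqp_solves_of_steps (bnd : nat -> R) eps : 0 <= bnd 0%N ->
  (forall k x, Xhat P x ->
    let G := @penalty R N S P (beta k.+1) (rho k.+1) in
    let lG := penalty_smoothness P (beta k.+1) (rho k.+1) in
    exists i, [/\ amp_stops_at (Xhat P) (v P) G alpha lF lG x (delta0 / gamma ^+ k.+1) i,
      Xhat P (amp_point (Xhat P) (v P) G alpha lF lG x i) &
      3 * i%:R <= bnd k.+1 - bnd k]) ->
  0 < eps -> eps < 1 ->
  exists T, gamma ^+ T <= gamma * residual_factor / eps /\
    ampqp_solves P alpha lth gamma delta0 beta0 rho0 x0
      (1 + S%:R * param_max * (gamma * residual_factor)) 0 eps (bnd T).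
Proof.
move=> bnd0 steps eps0 eps1; have c1 := residual_factor_ge1.
have [|T [T0 cT Tc]] := @exists_expr_between gamma (residual_factor / eps) gamma_gt1.
  by rewrite ltr_pdivlMr // mul1r (lt_le_trans eps1).
exists T; split; first by rewrite -mulrA.
have [x [c [run Xx crit cb]]] := ampqp_run_exists Xx0 bnd0 steps T.
exists T, x, c; split => //; have {}crit := crit T0.
have t0 := gammaX_gt0 T.
have cTe : residual_factor <= gamma ^+ T * eps by rewrite -ler_pdivrMr.
apply: (eps_solution_of_criterion t0 _ _ _ _ eps0 _ _ (beta_gt0 T) (rho_gt0 T) _ _ Xx _ crit).
- exact: ltW.
- exact: ltW.
- exact: param_max_ge0.
- by rewrite mulr_ge0 // (le_trans ler01).
- exact: le_trans cTe.
- by move: Tc; rewrite mulrA ler_pdivlMr.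
- by move=> s; rewrite /beta /beta_ mulrC ler_wpM2r ?(ltW t0) //; have [] := le_param_max s.
- by move=> s; rewrite /rho /rho_ mulrC ler_wpM2r ?(ltW t0) //; have [] := le_param_max s.
have le_beta s : param_min * gamma ^+ T <= beta T s.
  by rewrite /beta /beta_ mulrC ler_wpM2l ?(ltW t0) //; have [] := ge_param_min s.
have le_rho s : param_min * gamma ^+ T <= rho T s.
  by rewrite /rho /rho_ mulrC ler_wpM2l ?(ltW t0) //; have [] := ge_param_min s.
have res := residual_le param_min_gt0 t0 (ltW delta0_gt0) le_beta le_rho kkt Xx crit.
have ce : residual_factor / gamma ^+ T <= eps by rewrite ler_pdivrMr // mulrC.
by move=> s; have [pA pE] := res s; split; apply: le_trans ce.
Qed.

Lemma ampqp_monotone eps : alpha = 0 -> 0 < eps -> eps < 1 ->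
  ampqp_solves P alpha lth gamma delta0 beta0 rho0 x0
    (1 + S%:R * param_max * (gamma * residual_factor)) 0 eps
    (3 * (2 + (8 * L + 6 * lF) * D ^+ 2 / delta0) * (gamma / (gamma - 1))
     * (gamma * residual_factor) * eps^-1).
Proof.
move=> alpha0 eps0 eps1; set C0 := 2 + _.
have C00 : 0 <= C0.
  rewrite addr_ge0 // divr_ge0 ?(ltW delta0_gt0) // mulr_ge0 ?sqr_ge0 //.
  by rewrite addr_ge0 // mulr_ge0.
have g1 : 0 < gamma - 1 by rewrite subr_gt0.
(* [gamma / (gamma - 1)] is the geometric series factor: the increments of [bnd] are exactly the
   allowed costs of the runs. *)
pose bnd k := 3 * C0 * (gamma / (gamma - 1)) * gamma ^+ k.
have A0 : 0 <= 3 * C0 * (gamma / (gamma - 1)).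
  by apply: mulr_ge0; [exact: mulr_ge0 | rewrite divr_ge0 // ltW].
have bnd0 : 0 <= bnd 0%N by rewrite mulr_ge0 // ltW.
have bndS k : bnd k.+1 - bnd k = 3 * (C0 * gamma ^+ k.+1).
  by rewrite /bnd exprS; field; rewrite gt_eqF.
have [|T [gT [T' [x [c [run sol cb]]]]]] := ampqp_solves_of_steps bnd0 _ eps0 eps1.
  move=> k x Xx G lG.
  (* [lF <= 0] forces [N = 0]; all vectors are then equal. *)
  have [lFle|lFgt] := leP lF 0.
    exists 0%N; split => //; last first.
      by rewrite mulr0 bndS !mulr_ge0 // ltW.
    apply: amp_trivial_stop => //; first by rewrite divr_ge0 // ltW.
    move=> y y' Xy Xy'; apply/subr0_eq/dotxx_eq0.
    have N0 : N%:R <= 0 :> R.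
      by move: lFle; rewrite /lF pmulr_lle0 // => h; rewrite -sqrtr_eq0 eq_le h sqrtr_ge0.
    move: N0; rewrite (ler_nat R N 0) leqn0 => /eqP N0.
    rewrite dot_mxcol big1 // => i; by have := ltn_ord i; rewrite [X in (_ < X)%N]N0.
  have [i [stop_i Xi ile]] := amp_monotone_stop (@Xhat_convex_subset R N S P) (Xhat_proximinal Xx0)
    lipF monF (penalty_smooth_convex (beta_gt0 k.+1) (rho_gt0 k.+1))
    (penalty_smoothness_ge0 P (beta_gt0 k.+1) (rho_gt0 k.+1)) diam alpha0 lFgt Xx L_ge0
    (penalty_smoothness_le k.+1) delta0_gt0 (gammaX_ge1 k.+1).
  by exists i; split => //; rewrite bndS ler_wpM2l.
exists T', x, c; split => //; apply: le_trans cb _.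
by rewrite -[leRHS]mulrA; exact: ler_wpM2l.
Qed.

(** The constant of [amp_strong_stop] for [r] the root of [gamma]; the first logarithm contains the
    bound on the initial Lyapunov value, up to the power of [gamma]. *)
Definition strong_rate :=
  1 + 4 * (lF / alpha + Num.sqrt (L / alpha))
      * (ln ((1 + L / 2 * D ^+ 2 + `|D * V| + alpha / 2 * D ^+ 2) / delta0)
         + 4 * ln (Num.sqrt gamma)).

(** The number of runs is affine in [ln (1 / eps)]; dividing the constant part by [ln (1 / epsbar)]
    makes the bound proportional to [ln (1 / eps)]. *)
Definition outer_rate (epsbar : R) :=
  (ln (gamma * residual_factor) / ln gamma + 1) / ln (1 / epsbar) + (ln gamma)^-1.

Lemma outer_count_le eps epsbar T : 0 < eps -> eps <= epsbar -> epsbar < 1 ->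
  gamma ^+ T <= gamma * residual_factor / eps ->
  T.+1%:R <= outer_rate epsbar * ln (1 / eps).
Proof.
move=> eps0 le_eps eps1 gT.
have epsbar0 : 0 < epsbar by exact: lt_le_trans le_eps.
have gc1 : 1 <= gamma * residual_factor by rewrite mulr_ege1 ?residual_factor_ge1 // ltW.
have gc0 : 0 < gamma * residual_factor by exact: lt_le_trans gc1.
have lng : 0 < ln gamma by rewrite ln_gt0.
have lnbar : 0 < ln (1 / epsbar) by rewrite ln_gt0 // ltr_pdivlMr // mul1r.
have lneps : ln (1 / epsbar) <= ln (1 / eps).
  by rewrite ler_ln ?posrE ?divr_gt0 // !div1r lef_pV2 ?posrE.
have : T%:R * ln gamma <= ln (gamma * residual_factor) + ln (1 / eps).
  rewrite -lnM ?posrE ?divr_gt0 // div1r mulr_natl -lnXn ?(lt_trans ltr01) //.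
  by rewrite ler_ln ?posrE ?divr_gt0.
rewrite -ler_pdivlMr // -natr1 /outer_rate => hT.
apply: (@le_trans _ _ ((ln (gamma * residual_factor) + ln (1 / eps)) / ln gamma + 1)).
  by rewrite lerD2r.
have lnc : 0 <= ln (gamma * residual_factor) by rewrite ln_ge0.
have -> : (ln (gamma * residual_factor) + ln (1 / eps)) / ln gamma + 1 =
    ln (gamma * residual_factor) / ln gamma + 1 + (ln gamma)^-1 * ln (1 / eps).
  by rewrite mulrDl addrAC (mulrC (ln (1 / eps))).
rewrite [leRHS]mulrDl lerD2r [leRHS]mulrAC ler_pdivlMr // ler_wpM2l //.
by rewrite addr_ge0 // divr_ge0 // ltW.
Qed.

Lemma ampqp_strongly_monotone eps epsbar :
  0 < alpha -> 0 < eps -> eps <= epsbar -> epsbar < 1 ->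
  ampqp_solves P alpha lth gamma delta0 beta0 rho0 x0
    (1 + S%:R * param_max * (gamma * residual_factor)) 0 eps
    (3 * strong_rate * (Num.sqrt gamma / (Num.sqrt gamma - 1))
     * (outer_rate epsbar * Num.sqrt (gamma * residual_factor))
     * (eps `^ (- 2^-1) * ln (1 / eps))).
Proof.
move=> alpha0 eps0 le_eps eps1.
set r := Num.sqrt gamma; have r2 : r ^+ 2 = gamma by rewrite sqr_sqrtr.
have r1 : 1 < r by rewrite -sqrtr1 ltr_sqrt // (lt_trans ltr01).
have r0 : 0 < r by exact: lt_trans r1.
have D2 := sqr_ge0 D.
set C0 := strong_rate.
have M1 : 1 <= 1 + L / 2 * D ^+ 2 + `|D * V| + alpha / 2 * D ^+ 2.
  have LD : 0 <= L / 2 * D ^+ 2 by rewrite mulr_ge0 // divr_ge0.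
  have aD : 0 <= alpha / 2 * D ^+ 2 by rewrite mulr_ge0 // divr_ge0 // ltW.
  by rewrite -!addrA lerDl !addr_ge0.
have C00 : 0 <= C0.
  rewrite addr_ge0 // mulr_ge0 // ?addr_ge0 // ?mulr_ge0 // ?ln_ge0 ?(ltW r1) //.
    by rewrite addr_ge0 ?sqrtr_ge0 // divr_ge0 // ltW.
  by rewrite ler_pdivlMr // mul1r; exact: le_trans (ltW delta0_lt1) M1.
have s1 : 0 < r - 1 by rewrite subr_gt0.
pose A := 3 * C0 * (r / (r - 1)).
have A0 : 0 <= A by apply: mulr_ge0; [exact: mulr_ge0 | rewrite divr_ge0 // ltW].
pose bnd k := A * (k.+1%:R * r ^+ k).
have rk0 k : 0 <= r ^+ k by rewrite exprn_ge0 // ltW.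
have bnd0 : 0 <= bnd 0%N by apply: mulr_ge0 => //; exact: mulr_ge0.
(* [amp_strong_stop] is applied at [k.+1], which produces [k.+2]; the growth of the linear factor of
   [bnd] leaves the surplus [A * r ^+ k]. *)
have bndS k : 3 * (C0 * (k.+2%:R * r ^+ k.+1)) <= bnd k.+1 - bnd k.
  have -> : bnd k.+1 - bnd k = 3 * (C0 * (k.+2%:R * r ^+ k.+1)) + A * r ^+ k.
    by rewrite /bnd /A -[k.+2%:R]natr1 exprS; field; rewrite gt_eqF.
  by rewrite lerDl mulr_ge0.
have [|T [gT [T' [x [c [run sol cb]]]]]] :=
    ampqp_solves_of_steps bnd0 _ eps0 (le_lt_trans le_eps eps1).
  move=> k x Xx G lG.
  have [le_alF|lt_lFa] := leP alpha lF; last first.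
    exists 0%N; split => //; last first.
      by apply: le_trans (bndS k); rewrite mulr0 !mulr_ge0.
    by apply: amp_trivial_stop (Xhat_unique lt_lFa lF_ge0 mon lipF) => //; rewrite divr_ge0 // ltW.
  have := @amp_strong_stop R _ (Xhat P) (v P) G alpha lF lG (@Xhat_convex_subset R N S P)
    (Xhat_proximinal Xx0) lipF monF (penalty_smooth_convex (beta_gt0 k.+1) (rho_gt0 k.+1))
    (penalty_smoothness_ge0 P (beta_gt0 k.+1) (rho_gt0 k.+1)) L delta0
    (1 + L / 2 * D ^+ 2 + `|D * V| + alpha / 2 * D ^+ 2) r k.+1 x alpha0 le_alF Xx L_ge0.
  rewrite r2 => /(_ (penalty_smoothness_le k.+1) delta0_gt0 (ltW delta0_lt1) M1 r1) [].
    move=> z Xz.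
    (* A run may start anywhere in [Xhat P]: the penalty there is bounded by its distance to the
       feasible point [xs], the other terms by the data. *)
    have [xs [lam [mu [[Xs feasA feasE _ _] _]]]] := kkt.
    have penx := penalty_le_dist (beta_gt0 k.+1) (rho_gt0 k.+1) x
      (fun s => pospart_le0 (fun i => (feasA s i).1)) feasE.
    have penz := penalty_ge0 (beta_gt0 k.+1) (rho_gt0 k.+1) z.
    have lGd : lG / 2 * dot (x - xs) (x - xs) <= L * gamma ^+ k.+1 / 2 * D ^+ 2.
      apply: ler_pM; rewrite ?dotxx_ge0 ?diam //.
        by rewrite divr_ge0 // penalty_smoothness_ge0.
      by rewrite ler_wpM2r // penalty_smoothness_le.
    have dv : dot (x - z) (v P z) <= `|D * V|.
      have [diamD vV _] := data; apply: le_trans (cauchy_schwarz _ _) _.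
      by apply: le_trans (ler_norm _); rewrite ler_pM ?enorm_ge0 ?diamD ?vV.
    have ad : alpha / 2 * dot (z - x) (z - x) <= alpha / 2 * D ^+ 2.
      by rewrite ler_wpM2l ?diam // divr_ge0 // ltW.
    have := gammaX_ge1 k.+1; rewrite /gap.
    move: (gamma ^+ k.+1) lGd => t lGd t1.
    have c0 : 0 <= `|D * V| + alpha / 2 * D ^+ 2.
      by rewrite addr_ge0 // mulr_ge0 // divr_ge0 // ltW.
    have := ler_peMr c0 t1.
    rewrite /G in penx penz *; rewrite -/lG in penx; lra.
  move=> i [stop_i Xi ile]; exists i; split => //.
  by apply: le_trans (bndS k); rewrite ler_wpM2l.
exists T', x, c; split => //; apply: le_trans cb _.
rewrite /bnd -[leRHS]mulrA; apply: ler_wpM2l => //.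
have epsN : eps `^ (- 2^-1) = Num.sqrt (eps^-1).
  by rewrite powRN powR12_sqrt ?ltW // sqrtrV // ltW.
have rT : r ^+ T <= Num.sqrt (gamma * residual_factor) * eps `^ (- 2^-1).
  have gc0 : 0 <= gamma * residual_factor.
    by rewrite mulr_ge0 // (le_trans ler01) // residual_factor_ge1.
  rewrite epsN -sqrtrM // -(ger0_norm (rk0 T)) -sqrtr_sqr ler_wsqrtr //.
  by rewrite -exprM mulnC exprM r2.
apply: le_trans (ler_pM _ (rk0 T) (outer_count_le eps0 le_eps eps1 gT) rT) _; first by [].
by rewrite le_eqVlt; apply/orP; left; apply/eqP; ring.
Qed.

End Assembly.

Theorem theorem3p1 (R : realType) (N S : nat)
    (alpha lth D V K Lam gamma delta0 : R) (beta0 rho0 : 'I_S -> R)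
    (lth_gt0 : 0 < lth) (gamma_gt1 : 1 < gamma)
    (delta0_gt0 : 0 < delta0) (delta0_lt1 : delta0 < 1)
    (beta0_gt0 : forall s, 0 < beta0 s) (rho0_gt0 : forall s, 0 < rho0 s) :
  (alpha = 0 ->
     exists (C : R) (p : nat) (C' : R),
       forall P : ngnep R N S,
         player_lipschitz P lth -> ngnep_monotone P alpha ->
         KKT_bounded P Lam -> data_bounded P D V K ->
         forall x0, Xhat P x0 ->
         forall eps : R, 0 < eps -> eps < 1 ->
           ampqp_solves P alpha lth gamma delta0 beta0 rho0 x0 C p eps
             (C' * eps^-1))
  /\
  (0 < alpha ->
     forall epsbar : R, epsbar < 1 ->
     exists (C : R) (p : nat) (C' : R),
       forall P : ngnep R N S,
         player_lipschitz P lth -> ngnep_monotone P alpha ->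
         KKT_bounded P Lam -> data_bounded P D V K ->
         forall x0, Xhat P x0 ->
         forall eps : R, 0 < eps -> eps <= epsbar ->
           ampqp_solves P alpha lth gamma delta0 beta0 rho0 x0 C p eps
             (C' * (eps `^ (- 2^-1) * ln (1 / eps)))).
Proof.
split=> [alpha0|alpha_gt0 epsbar epsbar_lt1].
  (* The constants are opened before [P] is introduced, so they cannot depend on it or on its
     dimension. *)
  do 3 eexists; move=> P lip mon kkt data x0 Xx0 eps eps_gt0 eps_lt1.
  exact: (ampqp_monotone lth_gt0 gamma_gt1 delta0_gt0 delta0_lt1
    beta0_gt0 rho0_gt0 lip mon kkt data Xx0).
do 3 eexists; move=> P lip mon kkt data x0 Xx0 eps eps_gt0 le_eps.
exact: (ampqp_strongly_monotone lth_gt0 gamma_gt1 delta0_gt0 delta0_lt1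
  beta0_gt0 rho0_gt0 lip mon kkt data Xx0 alpha_gt0 eps_gt0 le_eps epsbar_lt1).
Qed.
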